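(* Let $(\Gamma,v)$ be a uniformly random labeled rooted $\mathrm{PSL}_2(\mathbb Z)$-reduced graph of size $n$. Then the average number of vertices of $\mathrm{silh}(\Gamma,v)$ is greater than $n-2n^{\frac23}+o(n^{\frac23})$. Moreover, for every $\mu>0$ there exists $0<\gamma<1$ such that the probability that $\mathrm{silh}(\Gamma,v)$ has less than $n-(2+\mu)n^{\frac23}$ vertices is $O(\gamma^{n^{1/3}})$.
   Context: Consider finite connected graphs with undirected $a$-edges and directed $b$-edges such that: every vertex lies on at most one $a$-edge, which is either an $a$-loop or an isolated $a$-edge (joining two distinct vertices); the $b$-edges form a partial injective map on vertices, and each $b$-edge is a $b$-loop, or an isolated $b$-edge (joining two distinct vertices lying on no other $b$-edge), or one of the edges of a $b$-triangle (a directed 3-cycle on three distinct vertices). Such a graph is $\mathrm{PSL}_2(\mathbb Z)$-cyclically reduced if every vertex is adjacent to an $a$-edge and to a $b$-edge; a rooted such graph $(\Gamma,v)$ is $\mathrm{PSL}_2(\mathbb Z)$-reduced if every vertex except possibly the root $v$ is adjacent to an $a$-edge and to a $b$-edge. The size of a graph is its number of vertices; it is labeled if its vertex set of size $n$ is $\{1,\dots,n\}$. ''Random'' refers to the uniform distribution on labeled rooted $\mathrm{PSL}_2(\mathbb Z)$-reduced graphs of size $n$. Special graphs: $\Delta_1$ has one vertex carrying an $a$-loop and a $b$-loop; $\Delta_2$ has two vertices joined by an isolated $a$-edge and by an isolated $b$-edge; $\Delta_3$ has two vertices joined by an isolated $b$-edge, each carrying an $a$-loop. Moves on a cyclically reduced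 graph (deleting a vertex also deletes its adjacent edges): - $\lambda_3$: if $v$ carries a $b$-loop and an isolated $a$-edge joins $v$ to $w\ne v$, delete $v$ and add an $a$-loop at $w$. - $\lambda_{2,1}$: if $v$ carries an $a$-loop and lies on a $b$-triangle $w\to v\to w'\to w$, delete $v$ (the $b$-edge $w'\to w$ becomes isolated). - $\lambda_{2,2}$: if $v$ carries an $a$-loop, an isolated $b$-edge (of either orientation) joins $v$ and $w\ne v$, and an isolated $a$-edge joins $w$ to $w'\notin\{v,w\}$, delete $v$ and $w$ and add an $a$-loop at $w'$. - $\kappa_3$: if there is an isolated $b$-edge $v\to w$, and isolated $a$-edges join $v$ to $v'$ and $w$ to $w'$ with $v,w,v',w'$ pairwise distinct, delete $v$ and $w$ and add an isolated $a$-edge between $v'$ and $w'$. - $\mathrm{exc}$: if the graph is $\Delta_3$ with $b$-edge $v\to w$, replace it by $\Delta_1$ with vertex $v$. The silhouette $\mathrm{silh}(\Gamma)$ of a cyclically reduced graph is the graph obtained by applying a maximal sequence of moves to $\Gamma$ (then relabeling vertices in an order-preserving way by $1,\dots,s$); its number of vertices does not depend on the sequence chosen. For a rooted $\mathrm{PSL}_2(\mathbb Z)$-reduced graph $(\Gamma,v)$, $\mathrm{silh}(\Gamma,v)$ is the silhouette of the cyclically reduced graph obtained by forgetting the root and adding at $v$ a loop labeled by the missing letter, if $v$ is not adjacent to an $a$-edge or not adjacent to a $b$-edge. *)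

(* Defs.v *)
From HB Require Import structures.
From mathcomp Require Import all_boot all_order all_algebra.

Set Implicit Arguments.
Unset Strict Implicit.
Unset Printing Implicit Defensive.

(* An undirected a-edge is the set of its endpoints: [set v] is an a-loop at v
   and [set v; w] with v != w joins v to w.  A directed b-edge v -> w is the
   pair (v, w).  The vertex set is a subset of an ambient finite type, so that
   vertices can be deleted without changing the type. *)
Record graph (V : finType) := Graph {
  verts : {set V};
  aedges : {set {set V}};
  bedges : {set V * V} }.

Section GraphFinite.
Variable V : finType.

Definition graph_code (G : graph V) := (verts G, aedges G, bedges G).
Definition graph_decode (c : {set V} * {set {set V}} * {set V * V}) :=
  Graph c.1.1 c.1.2 c.2.

Lemma graph_codeK : cancel graph_code graph_decode.
Proof. by case. Qed.

HB.instance Definition _ := Finite.copy (graph V) (can_type graph_codeK).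

End GraphFinite.

Section Graphs.
Variable V : finType.
Implicit Types (G H K : graph V) (u v w : V).

Definition a_loop G v := [set v] \in aedges G.
Definition b_loop G v := (v, v) \in bedges G.

Definition a_edge G v w := (v != w) && ([set v; w] \in aedges G).

Definition isolated_b_edge G v w :=
  [&& v != w, (v, w) \in bedges G &
   [forall e in bedges G, (e != (v, w)) ==>
      (e.1 \notin [set v; w]) && (e.2 \notin [set v; w])]].

Definition b_triangle G u v w :=
  [&& uniq [:: u; v; w], (u, v) \in bedges G, (v, w) \in bedges G
    & (w, u) \in bedges G].

Definition a_adjacent G v := [exists e in aedges G, v \in e].
Definition b_adjacent G v := [exists e in bedges G, (v == e.1) || (v == e.2)].

Definition a_edges_ok G :=
  [forall e in aedges G, (e \subset verts G) && (0 < #|e| <= 2)] &&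
  [forall v, #|[set e in aedges G | v \in e]| <= 1].

Definition b_partial_injection G :=
  [forall e in bedges G, forall f in bedges G, (e.1 == f.1) == (e.2 == f.2)].

Definition b_edges_ok G :=
  [&& [forall e in bedges G, (e.1 \in verts G) && (e.2 \in verts G)],
      b_partial_injection G
    & [forall e in bedges G,
        [|| e.1 == e.2, isolated_b_edge G e.1 e.2
          | [exists w, b_triangle G e.1 e.2 w]]]].

Definition neighbours G : rel V := fun u v =>
  [|| [set u; v] \in aedges G, (u, v) \in bedges G | (v, u) \in bedges G].

Definition connected_graph G :=
  [forall u in verts G, forall v in verts G, connect (neighbours G) u v].

Definition wf_graph G :=
  [&& verts G != set0, a_edges_ok G, b_edges_ok G & connected_graph G].

Definition cyclically_reduced G :=
  wf_graph G && [forall u in verts G, a_adjacent G u && b_adjacent G u].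

Definition rooted_reduced G v :=
  [&& wf_graph G, v \in verts G
    & [forall u in verts G, (u != v) ==> a_adjacent G u && b_adjacent G u]].

Definition delete G (D : {set V}) :=
  Graph (verts G :\: D) [set e in aedges G | [disjoint e & D]]
        [set e in bedges G | (e.1 \notin D) && (e.2 \notin D)].

Definition add_a G (e : {set V}) := Graph (verts G) (e |: aedges G) (bedges G).
Definition add_b G (e : V * V) := Graph (verts G) (aedges G) (e |: bedges G).

Definition Delta1 v := Graph [set v] [set [set v]] [set (v, v)].
Definition Delta3 v w :=
  Graph [set v; w] [set [set v]; [set w]] [set (v, w)].

Definition lambda3 G H :=
  [exists v, exists w, [&& b_loop G v, a_edge G v w
    & H == add_a (delete G [set v]) [set w]]].

Definition lambda21 G H :=
  [exists v, exists w, exists w', [&& a_loop G v, b_triangle G w v w'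
    & H == delete G [set v]]].

Definition lambda22 G H :=
  [exists v, exists w, exists w',
   [&& a_loop G v, isolated_b_edge G v w || isolated_b_edge G w v,
       a_edge G w w', w' \notin [set v; w]
     & H == add_a (delete G [set v; w]) [set w']]].

Definition kappa3 G H :=
  [exists v, exists w, exists v', exists w',
   [&& isolated_b_edge G v w, a_edge G v v', a_edge G w w',
       uniq [:: v; w; v'; w']
     & H == add_a (delete G [set v; w]) [set v'; w']]].

Definition exc G H :=
  [exists v, exists w, [&& v != w, G == Delta3 v w & H == Delta1 v]].

Definition move : rel (graph V) := fun G H =>
  [|| lambda3 G H, lambda21 G H, lambda22 G H, kappa3 G H | exc G H].

Definition maximal_reduct G H :=
  connect move G H && [forall K, ~~ move H K].

(* Every move on a cyclically reduced graph lowers the number of vertices, so a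
   maximal reduct exists; [pick] fixes one of them (all have the same number of
   vertices), and the default value is only reached on other graphs. *)
Definition reduct G : graph V := odflt G [pick H | maximal_reduct G H].

Definition forget_root G v :=
  let G' := if a_adjacent G v then G else add_a G [set v] in
  if b_adjacent G v then G' else add_b G' (v, v).

End Graphs.

(* [enum_val] lists the elements of a subset of 'I_n in increasing order, so
   this is the order-preserving relabeling. *)
Definition relabel n (G : graph 'I_n) : graph 'I_#|verts G| :=
  let f : 'I_#|verts G| -> 'I_n := @enum_val _ (mem (verts G)) in
  Graph setT [set e : {set 'I_#|verts G|} | f @: e \in aedges G]
    [set e | (f e.1, f e.2) \in bedges G].

Definition silh n (G : graph 'I_n) : graph 'I_#|verts (reduct G)| :=
  relabel (reduct G).

(* 'I_n = {0, ..., n-1} plays the role of {1, ..., n}. *)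
Definition labeled_rooted_reduced n : {set graph 'I_n * 'I_n} :=
  [set x | (verts x.1 == setT) && rooted_reduced x.1 x.2].

Definition rooted_silh_size n (x : graph 'I_n * 'I_n) : nat :=
  #|verts (silh (forget_root x.1 x.2))|.

Local Open Scope ring_scope.

Definition average (R : realFieldType) (T : finType) (S : {set T})
    (X : T -> R) : R :=
  (\sum_(x in S) X x) / #|S|%:R.

Definition uniform_proba (R : realFieldType) (T : finType) (S : {set T})
    (E : pred T) : R :=
  #|[set x in S | E x]|%:R / #|S|%:R.

(* Main.v *)
Require Import Defs.
From mathcomp Require Import all_boot all_order all_algebra.
From mathcomp Require Import zify.

(* Each silhouette move decreases the potential
     4 #(b-loops) + 3 #(a-loops) + 2 #(isolated b-edges)
   by at least the number of deleted vertices, so the silhouette loses at most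
   as many vertices as the potential of the initial graph.  A cyclically
   reduced graph is a connected pair of an a-structure and a b-structure, each
   a family of blocks (edges, loops, triangles) covering every vertex exactly
   once.  In such a pair, not conditioned to be connected, the numbers of
   b-loops, a-loops and isolated b-edges are typically n^(1/3), n^(1/2) and
   n^(2/3), with exponential tails obtained from factorial moments of order
   about n^(1/3).  Finally a union bound over invariant subsets shows that at
   least half of the pairs are connected for large n, so conditioning on
   connectedness costs only a constant factor. *)

Set Implicit Arguments.
Unset Strict Implicit.
Unset Printing Implicit Defensive.

(** * The potential *)

Section Potential.
Variable V : finType.
Implicit Types (G H : graph V) (u v w : V).

(** The constant 2 of the statement is the weight of an isolated b-edge in the potential; the two
    kinds of loops are of lower order than n^(2/3).

    No precise asymptotics of the numbers a(n) and b(n) of a- and b-structures are used. Their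
    linear recurrences are enough to compare them with (n!)^(1/2) and (n!)^(2/3), up to factors that
    grow more slowly than any exponential.

    The union bound works because 1/2 + 2/3 exceeds 1. Cutting the n vertices into k and n-k offers
    C(n,k) choices and costs about C(n,k)^(-7/6), so C(n,k)^(-1/6) remains; for k at most n/2 this
    beats the correction theta^(2k) with theta close to 1.

    The rate gamma^(n^(1/3)) reflects the order of the moments. Once a threshold exceeds the typical
    count by a fixed factor, raising the order by a bounded amount gains a constant factor. An order
    of about n^(1/3) is still negligible against n^(2/3), so falling factorials stay close to
    powers. *)

Definition b_loops G := [set v | (v, v) \in bedges G].
Definition a_loops G := [set v | [set v] \in aedges G].
Definition b_isolated G := [set e : V * V | isolated_b_edge G e.1 e.2].

(** The weights are forced from the bottom up. [kappa3] deletes two vertices and may only lose one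
    isolated b-edge, hence 2; [lambda21] trades an a-loop for an isolated b-edge and deletes one
    vertex, hence 3; [lambda3] trades a b-loop for an a-loop, hence 4. [exc] goes from 3 + 3 + 2 to
    4 + 3, which is exactly enough. *)
Definition potential G :=
  4 * #|b_loops G| + 3 * #|a_loops G| + 2 * #|b_isolated G|.

Lemma b_partial_injectionP G :
  reflect {in bedges G &, forall e f, (e.1 == f.1) = (e.2 == f.2)}
          (b_partial_injection G).
Proof.
apply: (iffP idP) => [/forallP h e f eG fG|h].
  by have /implyP/(_ eG)/forallP/(_ f)/implyP/(_ fG)/eqP := h e.
by apply/forallP=> e; apply/implyP=> eG; apply/forallP=> f; apply/implyP=> fG; apply/eqP/h.
Qed.

Lemma isolatedP G e :
  reflect [/\ e.1 != e.2, e \in bedges G &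
    {in bedges G, forall f, f != e -> (f.1 \notin [set e.1; e.2]) && (f.2 \notin [set e.1; e.2])}]
  (isolated_b_edge G e.1 e.2).
Proof.
rewrite /isolated_b_edge -surjective_pairing.
apply: (iffP and3P) => -[h1 h2 h3]; split=> //.
  by move=> f fG fe; have /forallP/(_ f)/implyP/(_ fG)/implyP/(_ fe) := h3.
by apply/forallP=> f; apply/implyP=> fG; apply/implyP=> fe; apply: h3.
Qed.

Lemma card_verts_delete G (D : {set V}) : #|verts G| <= #|verts (delete G D)| + #|D|.
Proof. by rewrite /= -(cardsID D (verts G)) addnC leq_add2l subset_leq_card ?subsetIr. Qed.

(** A b-edge can become isolated only by losing a b-edge that touched it. The witness [f] is then
    pinned down by partial injectivity in each move. *)
Lemma isolated_delete G (D : {set V}) e :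
  isolated_b_edge (delete G D) e.1 e.2 -> ~~ isolated_b_edge G e.1 e.2 ->
  exists f, [/\ f \in bedges G, (f.1 \in D) || (f.2 \in D),
     (f.1 \in [set e.1; e.2]) || (f.2 \in [set e.1; e.2]),
     e \in bedges G & (e.1 \notin D) && (e.2 \notin D)].
Proof.
move=> /isolatedP[h1]; rewrite inE => /andP[eG eD] h3 niso.
case: (pickP [pred f | [&& f \in bedges G, (f.1 \in D) || (f.2 \in D) &
     (f.1 \in [set e.1; e.2]) || (f.2 \in [set e.1; e.2])]]) => [f /and3P[? ? ?]|none].
  by exists f.
case/negP: niso; apply/isolatedP; split=> // f fG fe.
case fD: ((f.1 \in D) || (f.2 \in D)).
  by have := none f; rewrite /= fG fD /= => /negbT; rewrite negb_or.
by apply: h3; rewrite // inE fG /= -negb_or fD.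
Qed.

Lemma lambda3_potential G H : b_partial_injection G -> lambda3 G H ->
  #|verts G| + potential H <= #|verts H| + potential G.
Proof.
move=> /b_partial_injectionP inj /existsP[v /existsP[w /and3P[vb /andP[vw aw] /eqP ->]]].
set H' := add_a _ _.
have hv : #|verts G| <= #|verts H'| + 1 by rewrite -(cards1 v); exact: card_verts_delete.
have hb : #|b_loops H'| < #|b_loops G|.
  rewrite (cardsD1 v (b_loops G)) inE -/(b_loop G v) vb ltnS.
  by apply: subset_leq_card; apply/subsetP=> x; rewrite !inE /= andbb => /andP[-> ->].
have ha : #|a_loops H'| <= #|a_loops G| + 1.
  rewrite -[X in _ <= _ + X](cards1 w); apply: leq_trans (leq_card_setU _ _).
  apply: subset_leq_card; apply/subsetP=> x; rewrite !inE /= (inj_eq set1_inj).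
  by case/orP=> [->|/andP[->]]; rewrite ?orbT.
have hk : #|b_isolated H'| <= #|b_isolated G|.
  apply: subset_leq_card; apply/subsetP=> e; rewrite !inE => iso.
  apply/negPn/negP=> niso.
  have [f [fG]] := @isolated_delete G [set v] e iso niso.
  rewrite !inE => fv fe eG.
  (* The loop uses [v] both as source and as target, so by injectivity it is the only b-edge at [v];
     but then [e], which avoids [v], could not touch [f]. *)
  have : f = (v, v).
    have := inj _ _ fG vb => /= E; case: f E fv {fG fe} => f1 f2 /=.
    by case: eqP => [->|_]; case: eqP => [->|_].
  move=> Ef; rewrite Ef /= in fe.
  by rewrite (eq_sym e.1) (eq_sym e.2); move: fe; case: eqP; case: eqP.
by rewrite /potential; lia.
Qed.

Lemma lambda21_potential G H : b_partial_injection G -> lambda21 G H ->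
  #|verts G| + potential H <= #|verts H| + potential G.
Proof.
move=> /b_partial_injectionP inj
  /existsP[v /existsP[w /existsP[w' /and3P[va tri /eqP ->]]]].
case/and4P: tri => u3 wv vw' w'w.
set H' := delete _ _.
have hv : #|verts G| <= #|verts H'| + 1 by rewrite -(cards1 v); exact: card_verts_delete.
have hb : #|b_loops H'| <= #|b_loops G|.
  by apply: subset_leq_card; apply/subsetP=> x; rewrite !inE /= => /andP[->].
have ha : #|a_loops H'| < #|a_loops G|.
  rewrite (cardsD1 v (a_loops G)) inE -/(a_loop G v) va ltnS.
  apply: subset_leq_card; apply/subsetP=> x; rewrite !inE /= => /andP[->].
  by rewrite disjoints1 inE andbT eq_sym.
have hk : #|b_isolated H'| <= #|b_isolated G| + 1.
  rewrite -[X in _ <= _ + X](cards1 (w', w)); apply: leq_trans (leq_card_setU _ _).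
  apply: subset_leq_card; apply/subsetP=> e; rewrite !inE => iso.
  case niso : (isolated_b_edge G e.1 e.2) => //=.
  have [f [fG]] := @isolated_delete G [set v] e iso (negbT niso).
  rewrite !inE => fv fe eG /andP[ev1 ev2].
  (* By injectivity the only b-edges at [v] are [(w, v)] and [(v, w')]. Hence [e] touches [w] or
     [w'] while avoiding [v], and injectivity identifies it with the third side [(w', w)]. *)
  move: u3; rewrite /= !inE !negb_or !andbT => /andP[/andP[wv_ ww'_] vw'_].
  have e1 := inj _ _ eG wv; have e2 := inj _ _ eG vw'; have e3 := inj _ _ eG w'w.
  have f1 := inj _ _ fG wv; have f2 := inj _ _ fG vw'; have f3 := inj _ _ fG w'w.
  move: fv fe ev1 ev2 e1 e2 e3 f1 f2 f3; case: (e) (f) => [x y] [z t] /=.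
  rewrite xpair_eqE => fv fe; move=> /negbTE xv /negbTE yv; rewrite xv yv => e1 e2 e3 f1 f2 f3.
  rewrite -e3 andbb.
  case/orP: fv => /eqP E; rewrite E in fe f1 f2.
    have E2 : t = w' by apply/eqP; rewrite -f2 eqxx.
    by move: fe; rewrite E2 (eq_sym v x) (eq_sym v y) xv yv (eq_sym w' x) (eq_sym w' y) -e2 /= orbF.
  have E2 : z = w by apply/eqP; rewrite f1 eqxx.
  by move: fe; rewrite E2 (eq_sym v x) (eq_sym v y) xv yv (eq_sym w x) (eq_sym w y) e1 e3 /= orbF.
by rewrite /potential; lia.
Qed.

(** Shared by [lambda22] and [kappa3]: no other b-edge touches [v] or [w], so the deletion destroys
    one isolated b-edge and creates none. *)
Lemma isolated_deletion G v w (e : {set V}) H : isolated_b_edge G v w ->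
  H = add_a (delete G [set v; w]) e ->
  [/\ #|verts G| <= #|verts H| + 2, #|b_loops H| <= #|b_loops G| &
      #|b_isolated H| < #|b_isolated G|].
Proof.
move=> iso ->; have := iso; rewrite -[v]/(v, w).1 -[w]/(v, w).2 => /isolatedP [/= vw vwG far].
have {}far : {in bedges G, forall f, f != (v, w) -> (f.1 \notin [set v; w]) && (f.2 \notin [set v; w])} := far.
split.
- by have := card_verts_delete G [set v; w]; rewrite cards2 vw.
- by apply: subset_leq_card; apply/subsetP=> x; rewrite !inE /= => /andP[->].
rewrite (cardsD1 (v, w) (b_isolated G)) inE iso ltnS.
apply: subset_leq_card; apply/subsetP=> f; rewrite !inE => isof.
apply/andP; split.
  apply/eqP=> fE; move/isolatedP: isof => [_]; rewrite fE /=.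
  by rewrite !inE /= !eqxx !andbF.
apply/negPn/negP=> niso.
have [g [gG gD gf fG /andP[fD1 fD2]]] := @isolated_delete G [set v; w] f isof niso.
have gE : g = (v, w).
  by apply/eqP/negPn/negP=> /(far _ gG) /andP[g1 g2]; rewrite (negbTE g1) (negbTE g2) in gD.
move: gf fD1 fD2; rewrite gE !inE /= (eq_sym v f.1) (eq_sym v f.2) (eq_sym w f.1) (eq_sym w f.2).
by do 4 case: eqP => //.
Qed.

Lemma lambda22_potential G H : lambda22 G H ->
  #|verts G| + potential H <= #|verts H| + potential G.
Proof.
case/existsP=> v /existsP[w /existsP[w' /and5P[va iso aww' w'n /eqP HE]]].
have [h1 h2 h3] : [/\ #|verts G| <= #|verts H| + 2, #|b_loops H| <= #|b_loops G| &
      #|b_isolated H| < #|b_isolated G|].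
  case/orP: iso => iso; first exact: isolated_deletion iso HE.
  by move: HE; rewrite setUC; apply: isolated_deletion.
have ha : #|a_loops H| <= #|a_loops G|.
  have -> : #|a_loops G| = (#|a_loops G :\ v| + #|[set w']|).
    by rewrite cards1 (cardsD1 v (a_loops G)) inE -/(a_loop G v) va addnC.
  apply: leq_trans (leq_card_setU _ _).
  apply: subset_leq_card; apply/subsetP=> x; rewrite HE !inE /= (inj_eq set1_inj).
  case/orP=> [->|/andP[->]]; rewrite ?orbT ?andbT //.
  by rewrite disjoints1 !inE negb_or => /andP[->].
by rewrite /potential; lia.
Qed.

Lemma kappa3_potential G H : kappa3 G H ->
  #|verts G| + potential H <= #|verts H| + potential G.
Proof.
case/existsP=> v /existsP[w /existsP[v' /existsP[w' /and5P[iso avv' aww' u4 /eqP HE]]]].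
have [h1 h2 h3] := isolated_deletion iso HE.
have ha : #|a_loops H| <= #|a_loops G|.
  apply: subset_leq_card; apply/subsetP=> x; rewrite HE !inE /= => /orP[/eqP E|/andP[->]//].
  have := congr1 (fun A : {set V} => #|A|) E; rewrite cards1 cards2.
  by move: u4; rewrite /= !inE !negb_or => /and4P[_ _ -> _].
by rewrite /potential; lia.
Qed.

Lemma exc_potential G H : exc G H ->
  b_partial_injection H /\ #|verts G| + potential H <= #|verts H| + potential G.
Proof.
case/existsP=> v /existsP[w /and3P[vw /eqP -> /eqP ->]]; split.
  by apply/b_partial_injectionP=> e f /set1P-> /set1P->.
rewrite /potential /= cards2 cards1 vw.
have -> : #|b_loops (Delta1 v)| = 1.
  by apply/eqP/cards1P; exists v; apply/setP=> x; rewrite !inE xpair_eqE andbb.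
have -> : #|a_loops (Delta1 v)| = 1.
  by apply/eqP/cards1P; exists v; apply/setP=> x; rewrite !inE (inj_eq set1_inj).
have -> : #|b_isolated (Delta1 v)| = 0.
  apply/eqP; rewrite cards_eq0; apply/eqP/setP=> -[x y]; rewrite !inE.
  by apply/negP=> /isolatedP[/= xy /set1P[E1 E2] _]; rewrite E1 E2 eqxx in xy.
have -> : #|a_loops (Delta3 v w)| = 2.
  have -> : a_loops (Delta3 v w) = [set v; w].
    by apply/setP=> x; rewrite !inE !(inj_eq set1_inj).
  by rewrite cards2 vw.
suff : (v, w) \in b_isolated (Delta3 v w) by rewrite (cardsD1 (v, w)) => ->; lia.
rewrite inE; apply/isolatedP; split; rewrite ?inE //= => f /set1P -> /=.
by rewrite eqxx.
Qed.

Lemma sub_b_partial_injection G H : bedges H \subset bedges G ->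
  b_partial_injection G -> b_partial_injection H.
Proof.
move=> /subsetP sub /b_partial_injectionP inj; apply/b_partial_injectionP.
by move=> e f /sub eG /sub fG; apply: inj.
Qed.

Lemma bedges_delete G (D : {set V}) : bedges (delete G D) \subset bedges G.
Proof. by apply/subsetP=> e; rewrite inE => /andP[]. Qed.

(** Partial injectivity travels along a sequence of moves: every move but [exc] only deletes
    b-edges, and [exc] leaves a single one. *)
Lemma move_potential G H : b_partial_injection G -> move G H ->
  b_partial_injection H /\ #|verts G| + potential H <= #|verts H| + potential G.
Proof.
move=> inj; have sub := sub_b_partial_injection _ inj.
case/or4P=> [h|h|h|/orP[h|h]]; last exact: exc_potential.
- split; last exact: lambda3_potential.
  by case/existsP: h => v /existsP[w /and3P[_ _ /eqP->]]; exact/sub/bedges_delete.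
- split; last exact: lambda21_potential.
  by case/existsP: h => v /existsP[w /existsP[w' /and3P[_ _ /eqP->]]]; exact/sub/bedges_delete.
- split; last exact: lambda22_potential.
  by case/existsP: h => v /existsP[w /existsP[w' /and5P[_ _ _ _ /eqP->]]]; exact/sub/bedges_delete.
- split; last exact: kappa3_potential.
  case/existsP: h => v /existsP[w /existsP[v' /existsP[w' /and5P[_ _ _ _ /eqP->]]]].
  exact/sub/bedges_delete.
Qed.

(** The drops are added up along the chain of moves. In the default case of [reduct] no vertex is
    lost and the bound is trivial. *)
Lemma reduct_potential G : b_partial_injection G ->
  #|verts G| <= #|verts (reduct G)| + potential G.
Proof.
move=> inj; rewrite /reduct; case: pickP => [H /andP[/connectP[p pth ->] _]|_] /=; last first.
  exact: leq_addr.
apply: leq_trans (leq_addr (potential (last G p)) _) _.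
elim: p G inj pth => //= K p IH G inj /andP[/(move_potential inj)[injK le1] /(IH _ injK) le2].
lia.
Qed.

End Potential.

(** * Packings by blocks *)

Section Packings.
Variables (V E : finType) (supp : E -> {set V}) (B : {set E}).
Hypothesis supp_neq0 : {in B, forall b, supp b != set0}.
Implicit Types (D A : {set V}) (P Q : {set E}) (b c : E) (v : V).

Definition cover_mult P v := \sum_(b in P) (v \in supp b).

(** Different blocks can have the same support, such as the two orientations of a b-edge, so a
    packing is not a partition of vertices. Equating the multiplicity with the indicator of [D]
    makes the supports disjoint, contained in [D] and covering [D], all at once. *)
Definition packings D : {set {set E}} :=
  [set P : {set E} | (P \subset B) && [forall v, cover_mult P v == (v \in D)]].

Lemma packingsP D P :
  reflect (P \subset B /\ forall v, cover_mult P v = (v \in D)) (P \in packings D).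
Proof.
rewrite inE; apply: (iffP andP) => -[PB h]; split=> //.
  by move=> v; apply/eqP/(forallP h).
by apply/forallP=> v; apply/eqP.
Qed.

Lemma packing_block_sub D P b : P \in packings D -> b \in P -> supp b \subset D.
Proof.
case/packingsP=> _ h bP; apply/subsetP=> v vb.
have := h v; rewrite /cover_mult (big_setD1 b) //= vb.
by case: (v \in D).
Qed.

Lemma packing_block_uniq D P b c v : P \in packings D -> b \in P -> c \in P ->
  v \in supp b -> v \in supp c -> b = c.
Proof.
case/packingsP=> _ h bP cP vb vc; apply/eqP/negPn/negP=> bc.
have := h v; rewrite /cover_mult (big_setD1 b) //= (big_setD1 c) /=; last first.
  by rewrite !inE eq_sym bc.
by rewrite vb vc; case: (v \in D).
Qed.

Lemma packing_cover D P v : P \in packings D -> v \in D ->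
  exists2 b, b \in P & v \in supp b.
Proof.
case/packingsP=> _ h vD; have := h v; rewrite vD /cover_mult => h1.
case: (pickP [pred b | (b \in P) && (v \in supp b)]) => [b /andP[bP vb]|none].
  by exists b.
rewrite big1 // in h1 => b bP.
by have := none b; rewrite /= bP /= => ->.
Qed.

Lemma packings_set0 : packings set0 = [set set0].
Proof.
apply/setP=> P; rewrite in_set1; apply/idP/eqP=> [PP|->].
  apply/setP=> b; rewrite inE; apply/negP=> bP.
  have /packingsP[/subsetP/(_ b bP)/supp_neq0 /set0Pn[v vb] _] := PP.
  by have := subsetP (packing_block_sub PP bP) v vb; rewrite inE.
apply/packingsP; split; rewrite ?sub0set // => v.
by rewrite /cover_mult big_set0 inE.
Qed.

Lemma packing_insert D P b : b \in B -> supp b \subset D ->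
  P \in packings (D :\: supp b) -> b \notin P /\ b |: P \in packings D.
Proof.
move=> bB bD PP; have bP : b \notin P.
  apply/negP=> bP; have /set0Pn[v vb] := supp_neq0 bB.
  by have := subsetP (packing_block_sub PP bP) v vb; rewrite inE vb.
split=> //; case/packingsP: PP => PB h; apply/packingsP; split.
  by rewrite subUset sub1set bB.
move=> v; rewrite /cover_mult big_setU1 //= [X in _ + X]h inE.
by case vb: (v \in supp b) => //=; rewrite (subsetP bD v vb).
Qed.

Lemma packing_remove D P b : P \in packings D -> b \in P ->
  P :\ b \in packings (D :\: supp b).
Proof.
move=> PP bP; have bD := packing_block_sub PP bP.
case/packingsP: PP => PB h; apply/packingsP; split.
  exact: subset_trans (subD1set _ _) PB.
move=> v; have := h v; rewrite /cover_mult (big_setD1 b) //= inE.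
case vb: (v \in supp b) => //=.
by rewrite (subsetP bD v vb) add1n => -[].
Qed.

(** Removing [b] is a bijection onto the packings of what remains of [D]; reinserting [b] is its
    inverse. *)
Lemma sum_packings_containing D b (F : {set E} -> nat) : b \in B -> supp b \subset D ->
  \sum_(P in packings D | b \in P) F (P :\ b) =
  \sum_(P in packings (D :\: supp b)) F P.
Proof.
move=> bB bD; rewrite [RHS](reindex_onto (fun P => P :\ b) (fun P => b |: P)) /=; last first.
  by move=> P /(packing_insert bB bD)[bP _]; rewrite setU1K.
apply: eq_bigl => P; apply/andP/andP=> [[PP bP]|[PP /eqP PE]].
  by split; [exact: packing_remove | rewrite setD1K].
by have [_] := packing_insert bB bD PP; rewrite PE => ?; split=> //; rewrite -PE setU11.
Qed.

(** Double counting of the pairs formed by a packing and one of its blocks in [T]. *)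
Lemma sum_packings_blocks D (T : {set E}) (F : {set E} -> nat) : T \subset B ->
  \sum_(P in packings D) \sum_(b in P :&: T) F (P :\ b) =
  \sum_(b in T | supp b \subset D) \sum_(P in packings (D :\: supp b)) F P.
Proof.
move=> TB; under eq_bigr => P PP.
  rewrite (eq_bigl (fun b => [&& b \in T, supp b \subset D & b \in P])); last first.
    move=> b; rewrite inE andbC; case bT: (b \in T) => //=.
    by case bP: (b \in P); rewrite ?andbF ?andbT //= (packing_block_sub PP bP).
  over.
rewrite (exchange_big_dep (fun b => (b \in T) && (supp b \subset D))) /=; last first.
  by move=> P b _ /and3P[-> ->].
apply: eq_bigr => b /andP[bT bD].
rewrite -sum_packings_containing //; last exact: (subsetP TB).
by apply: eq_bigl => P; rewrite bT bD.
Qed.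

(** Packings are sorted by the unique block that covers [v]. *)
Lemma card_packings_rec D v : v \in D ->
  #|packings D| =
  \sum_(b in [set b in B | v \in supp b] | supp b \subset D) #|packings (D :\: supp b)|.
Proof.
move=> vD; have TB : [set b in B | v \in supp b] \subset B.
  by apply/subsetP=> b; rewrite inE => /andP[].
under [RHS]eq_bigr do rewrite -sum1_card.
rewrite -sum_packings_blocks // -sum1_card; apply: eq_bigr => P /packingsP[PB h].
transitivity (cover_mult P v); first by rewrite h vD.
rewrite /cover_mult.
rewrite big_mkcond /= [RHS]big_mkcond /=; apply: eq_bigr => b _; rewrite !inE.
by case bP: (b \in P) => //=; rewrite (subsetP PB b bP) /=; case: (v \in supp b).
Qed.

(* Falling factorials satisfy [X^_j.+1 = X * X.-1^_j], so factorial moments of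
   the number of blocks of a given type are obtained by extracting blocks one
   at a time. *)
Lemma sum_packings_ffact (T : {set E}) (x m : nat -> nat) s :
  T \subset B -> {in T, forall b, #|supp b| = s} ->
  (forall D, #|packings D| = x #|D|) ->
  (forall D, #|[set b in T | supp b \subset D]| = m #|D|) ->
  forall j D, \sum_(P in packings D) #|P :&: T| ^_ j =
    (\prod_(k < j) m (#|D| - s * k)) * x (#|D| - s * j).
Proof.
move=> TB Ts cx cm; elim=> [|j IH] D.
  by rewrite big_ord0 mul1n muln0 subn0 -cx -sum1_card; apply: eq_bigr => P _; rewrite ffactn0.
transitivity (\sum_(P in packings D) \sum_(b in P :&: T) #|(P :\ b) :&: T| ^_ j).
  apply: eq_bigr => P _.
  rewrite (eq_bigr (fun _ => #|P :&: T|.-1 ^_ j)); last first.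
    move=> b bPT; congr (_ ^_ _); rewrite (cardsD1 b (P :&: T)) bPT add1n /=.
    by apply: eq_card => c; rewrite !inE andbA.
  rewrite sum_nat_const; case: #|_| => [|k]; first by rewrite mul0n ffact0n.
  by rewrite ffactnS.
rewrite (sum_packings_blocks D (fun P => #|P :&: T| ^_ j) TB).
rewrite (eq_bigr (fun _ => (\prod_(k < j) m (#|D| - s - s * k)) * x (#|D| - s - s * j))); last first.
  by move=> b /andP[bT bD]; rewrite IH cardsD (setIidPr bD) Ts.
rewrite sum_nat_cond_const cm big_ord_recl muln0 subn0 mulnA; congr (_ * _ * _).
  by apply: eq_bigr => k _; rewrite /bump /= mulnS subnDA.
by rewrite mulnS subnDA.
Qed.

(** No block crosses the boundary of [A]. For an a- and a b-packing together, such sets are the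
    unions of connected components. *)
Definition invariant P A :=
  [forall b in P, (supp b \subset A) || [disjoint supp b & A]].

Lemma invariantC P A : invariant P (~: A) = invariant P A.
Proof.
apply: eq_forallb => b; case: (b \in P) => //=.
by rewrite orbC disjoints_subset setCK -disjoints_subset.
Qed.

(** An invariant packing is recovered from its blocks inside [A] and its blocks inside the
    complement, and these two parts are packings. *)
Lemma card_packings_invariant A :
  #|[set P in packings setT | invariant P A]| <= #|packings A| * #|packings (~: A)|.
Proof.
pose f P := ([set b in P | supp b \subset A], [set b in P | supp b \subset ~: A]).
have fP P : P \in [set P in packings setT | invariant P A] -> P = (f P).1 :|: (f P).2.
  rewrite inE => /andP[_ /forallP inv]; apply/setP=> b; rewrite !inE -andb_orr.
  have := inv b; case: (b \in P) => //= /orP[->//|]; rewrite disjoints_subset => ->.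
  by rewrite orbT.
rewrite -cardsX -(card_in_imset (f := f)); last first.
  by move=> P Q /fP PE /fP QE fPQ; rewrite PE QE fPQ.
apply: subset_leq_card; apply/subsetP=> _ /imsetP[P Pinv ->].
have PE := fP _ Pinv.
have restr A' (PP : P \in packings setT) :
    {in P, forall b, supp b \subset A' \/ [disjoint supp b & A']} ->
    [set b in P | supp b \subset A'] \in packings A'.
  move=> inv; case/packingsP: PP => PB h; apply/packingsP; split.
    by apply: subset_trans PB; apply/subsetP=> b; rewrite inE => /andP[].
  move=> v; case vA: (v \in A'); last first.
    rewrite /cover_mult big1 // => b; rewrite inE => /andP[_ /subsetP/(_ v)].
    by rewrite vA; case: (v \in supp b) => // /(_ isT).
  have := h v; rewrite inE => <-.
  rewrite /cover_mult big_mkcond /= [RHS]big_mkcond /=; apply: eq_bigr => b _.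
  rewrite inE; case bP: (b \in P) => //=; case: (inv b bP) => [->//|dis].
  have /negbTE-> : v \notin supp b by apply: contraTN vA => vb; rewrite (disjointFr dis).
  by case: ifP.
move: Pinv; rewrite inE => /andP[PP /forallP inv]; rewrite inE; apply/andP; split.
  by apply: restr => // b bP; have := inv b; rewrite bP /= => /orP.
apply: restr => // b bP; have := inv b; rewrite bP /= => /orP[s|]; last first.
  by rewrite disjoints_subset; left.
by right; rewrite disjoints_subset setCK.
Qed.

End Packings.

(** * The a-structures and b-structures *)

(** These are the involution numbers, with exponential generating function exp(x + x^2/2). *)
Fixpoint a_count n :=
  if n is n1.+1 then
    a_count n1 + (if n1 is n2.+1 then n1 * a_count n2 else 0)
  else 1.

(** The exponential generating function is exp(x + x^2 + x^3/3). A given vertex lies on its loop, on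
    two orientations of an edge to each other vertex, or on one directed triangle for each ordered
    pair of distinct other vertices. *)
Fixpoint b_count n :=
  if n is n1.+1 then
    b_count n1 +
    (if n1 is n2.+1 then
       2 * n1 * b_count n2 + (if n2 is n3.+1 then n1 * n2 * b_count n3 else 0)
     else 0)
  else 1.

Lemma a_countS n : a_count n.+1 = a_count n + n * a_count n.-1.
Proof. by case: n. Qed.

Lemma b_countS n :
  b_count n.+1 = b_count n + 2 * n * b_count n.-1 + n * n.-1 * b_count n.-2.
Proof. by case: n => [|[|n]] //=; rewrite !addnA. Qed.

Arguments a_count : simpl never.
Arguments b_count : simpl never.

Section Blocks.
Variable V : finType.
Implicit Types (D : {set V}) (u v w : V) (e f : V * V) (q : {set V * V}).

Definition a_loop_blocks : {set {set V}} := [set [set v] | v : V].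
Definition a_blocks : {set {set V}} := [set p : {set V} | 0 < #|p| <= 2].
Notation a_packings := (packings (@id {set V}) a_blocks).

Definition ends e := [set e.1; e.2].
Definition bsupp q := \bigcup_(e in q) ends e.
(** As a set of edges, a triangle does not depend on the vertex from which it is read. *)
Definition triangle (t : V * V * V) : {set V * V} :=
  [set (t.1.1, t.1.2); (t.1.2, t.2); (t.2, t.1.1)].
Definition b_loop_blocks : {set {set V * V}} := [set [set (v, v)] | v : V].
Definition b_edge_blocks : {set {set V * V}} := [set [set e] | e : V * V & e.1 != e.2].
Definition b_triangle_blocks : {set {set V * V}} :=
  [set triangle t | t : V * V * V & uniq [:: t.1.1; t.1.2; t.2]].
Definition b_blocks := b_loop_blocks :|: b_edge_blocks :|: b_triangle_blocks.
Notation b_packings := (packings bsupp b_blocks).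

Lemma a_blocks_neq0 : {in a_blocks, forall p, p != set0}.
Proof. by move=> p; rewrite inE card_gt0 => /andP[]. Qed.

Lemma bsupp1 e : bsupp [set e] = ends e.
Proof. by rewrite /bsupp big_set1. Qed.

Lemma bsupp_triangle t : bsupp (triangle t) = [set t.1.1; t.1.2; t.2].
Proof.
rewrite /bsupp /triangle !bigcup_setU !big_set1 /ends /=.
by apply/setP=> x; rewrite !inE; do 3 case: (x == _).
Qed.

Variant b_block_spec q : Prop :=
| BLoop v of q = [set (v, v)]
| BEdge e of q = [set e] & e.1 != e.2
| BTriangle t of q = triangle t & uniq [:: t.1.1; t.1.2; t.2].

Lemma b_blockP q : q \in b_blocks -> b_block_spec q.
Proof.
rewrite !in_setU => /orP[/orP[/imsetP[v _ ->]|/imsetP[e]]|/imsetP[t]].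
- exact: BLoop.
- by rewrite inE => ? ->; exact: BEdge.
- by rewrite inE => ? ->; exact: BTriangle.
Qed.

Lemma b_blocks_neq0 : {in b_blocks, forall q, bsupp q != set0}.
Proof.
move=> q /b_blockP[v ->|e -> _|t -> _]; apply/set0Pn.
- by exists v; rewrite bsupp1 !inE eqxx.
- by exists e.1; rewrite bsupp1 !inE eqxx.
- by exists t.1.1; rewrite bsupp_triangle !inE eqxx.
Qed.

Lemma card_a_packings D : #|a_packings D| = a_count #|D|.
Proof.
have [n] := ubnP #|D|; elim: n D => // n IH D; rewrite ltnS => Dn.
have [->|/set0Pn[v vD]] := eqVneq D set0.
  by rewrite packings_set0 ?cards1 ?cards0 //; exact: a_blocks_neq0.
rewrite (card_packings_rec a_blocks_neq0 vD).
have DE : #|D| = #|D :\ v|.+1 by rewrite (cardsD1 v) vD.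
rewrite DE a_countS.
rewrite (eq_bigl (mem ([set v] |: [set [set v; w] | w in D :\ v]))); last first.
  move=> p; rewrite /= !inE; apply/idP/idP.
    case/andP=> /andP[/andP[p0 p2] vp] pD.
    have pE : p = v |: (p :\ v) by rewrite setD1K.
    have : #|p :\ v| <= 1 by move: p2; rewrite (cardsD1 v) vp; lia.
    rewrite leq_eqVlt ltnS leqn0 cards_eq0 => /orP[/cards1P[w wE]|/eqP wE]; last first.
      by rewrite pE wE setU0 eqxx.
    apply/orP; right; apply/imsetP; exists w; last by rewrite pE wE.
    have : w \in p :\ v by rewrite wE inE.
    by rewrite !inE => /andP[-> /(subsetP pD)].
  case/orP=> [/eqP->|/imsetP[w]]; first by rewrite cards1 inE eqxx sub1set vD.
  rewrite !inE => /andP[wv wD] ->.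
  by rewrite cards2 !inE eqxx /= subUset !sub1set vD wD andbT; case: (v != w).
rewrite big_setU1 /=; last first.
  apply/imsetP=> -[w]; rewrite !inE => /andP[wv _] /(congr1 (fun A : {set V} => #|A|)).
  by rewrite cards1 cards2 eq_sym wv.
rewrite big_imset /=; last first.
  move=> w w'; rewrite !inE => /andP[wv _] /andP[wv' _] /setP/(_ w).
  by rewrite !inE eqxx orbT (negbTE wv) => /esym/eqP.
rewrite IH; last by rewrite DE in Dn.
congr (_ + _).
rewrite (eq_bigr (fun _ => a_count #|D :\ v|.-1)) ?sum_nat_const // => w wDv.
have E : D :\: [set v; w] = (D :\ v) :\ w by rewrite setDDl.
have E' : #|D :\ v| = #|(D :\ v) :\ w|.+1 by rewrite (cardsD1 w) wDv.
by rewrite E IH ?E' // -ltnS -E' -DE ltnW.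
Qed.

Lemma triangle_inj v (x y x' y' : V) : uniq [:: v; x; y] -> uniq [:: v; x'; y'] ->
  triangle (v, x, y) = triangle (v, x', y') -> (x, y) = (x', y').
Proof.
rewrite /= !inE !negb_or !andbT => /andP[/andP[vx vy] xy] /andP[/andP[vx' vy'] xy'] /setP E.
have := E (v, x); have := E (y, v); rewrite !inE !xpair_eqE /= !eqxx /=.
rewrite (eq_sym x) (eq_sym y v) (negbTE vx) (negbTE vy) (negbTE vx') (negbTE vy') ?andbF ?orbF /=.
by rewrite ?(eq_sym x v) ?(negbTE vx) ?andbF ?andbT ?orbF ?orbT /= => /esym/eqP -> /esym/eqP ->.
Qed.

Lemma card_b_packings D : #|b_packings D| = b_count #|D|.
Proof.
have [n] := ubnP #|D|; elim: n D => // n IH D; rewrite ltnS => Dn.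
have [->|/set0Pn[v vD]] := eqVneq D set0.
  by rewrite packings_set0 ?cards1 ?cards0 //; exact: b_blocks_neq0.
rewrite (card_packings_rec b_blocks_neq0 vD).
have DE : #|D| = #|D :\ v|.+1 by rewrite (cardsD1 v) vD.
(* The blocks that cover [v]: its loop ([S0]), the edges leaving it ([S1]), the edges entering it
   ([S2]), and the triangles, rotated so as to start at [v] ([S3]). Their disjointness splits the
   sum into the terms of the recurrence. *)
pose S0 : {set {set V * V}} := [set [set (v, v)]].
pose S1 : {set {set V * V}} := [set [set (v, w)] | w in D :\ v].
pose S2 : {set {set V * V}} := [set [set (w, v)] | w in D :\ v].
pose W := [set x : V * V | [&& x.1 \in D :\ v, x.2 \in D :\ v & x.1 != x.2]].
pose S3 : {set {set V * V}} := [set triangle (v, x.1, x.2) | x in W].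
have tri3 t : uniq [:: t.1.1; t.1.2; t.2] -> #|triangle t| = 3.
  case: t => -[x y] z /=; rewrite !inE !negb_or andbT => /andP[/andP[xy xz] yz].
  rewrite /triangle setUC cardsU1 cards2 !inE !xpair_eqE /=.
  by rewrite (eq_sym z y) (negbTE xy) (negbTE yz) (eq_sym z) (negbTE xz) andbF.
have WP x : x \in W -> uniq [:: v; x.1; x.2].
  rewrite !inE /= !inE negb_or andbT => /and3P[/andP[xv _] /andP[yv _] ->].
  by rewrite !(eq_sym v) xv yv.
have dec : [set q in b_blocks | (v \in bsupp q) && (bsupp q \subset D)]
    = S0 :|: S1 :|: S2 :|: S3.
  apply/setP=> q; rewrite in_set; apply/andP/idP.
    case=> qB; case/b_blockP: (qB) => [u|e|[[x y] z]] qE.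
    - rewrite qE bsupp1 /ends /= setUid sub1set in_set1 => /andP[/eqP <- _].
      by rewrite !inE eqxx.
    - case: e qE => x y qE /= xy; rewrite qE bsupp1 /ends /= subUset !sub1set.
      rewrite in_set2 => /andP[vxy /andP[xD yD]].
      case/orP: vxy => /eqP vE.
        rewrite !in_setU; do 2 (apply/orP; left); apply/orP; right.
        apply/imsetP; exists y; last by rewrite vE.
        by rewrite !inE yD andbT vE eq_sym.
      rewrite !in_setU; apply/orP; left; apply/orP; right.
      apply/imsetP; exists x; last by rewrite vE.
      by rewrite !inE xD andbT vE.
    - rewrite qE bsupp_triangle /= !subUset !sub1set.
      rewrite !inE !negb_or andbT => /andP[/andP[xy xz] yz].
      move=> /andP[vxyz /andP[/andP[xD yD] zD]].
      apply/orP; right; case/orP: vxyz => [/orP[]|] /eqP vE.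
      + apply/imsetP; exists (y, z); last by rewrite vE.
        by rewrite !inE /= vE yD zD !andbT (eq_sym y x) (eq_sym z x) xy xz yz.
      + apply/imsetP; exists (z, x); last first.
          by rewrite /triangle /= vE -setUA setUC.
        by rewrite !inE /= vE xD zD !andbT (eq_sym z y) (eq_sym z x) xy xz yz.
      + apply/imsetP; exists (x, y); last first.
          by rewrite /triangle /= vE setUC setUA.
        by rewrite !inE /= vE xD yD !andbT xy xz yz.
  rewrite !in_setU => /orP[/orP[/orP[/set1P->|/imsetP[w]]|/imsetP[w]]|/imsetP[x xW ->]].
  - by rewrite bsupp1 /ends /= setUid sub1set vD inE eqxx imset_f.
  - rewrite !inE => /andP[wv wD] ->; rewrite bsupp1 /ends /= subUset !sub1set vD wD !inE eqxx.
    split=> //; apply/orP; left; apply/orP; right; apply/imsetP; exists (v, w) => //.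
    by rewrite inE /= eq_sym.
  - rewrite !inE => /andP[wv wD] ->; rewrite bsupp1 /ends /= subUset !sub1set vD wD !inE eqxx.
    split; rewrite ?orbT //; apply/orP; left; apply/orP; right; apply/imsetP; exists (w, v) => //.
    by rewrite inE.
  - have xu := WP _ xW; split.
      by apply/orP; right; apply/imsetP; exists (v, x.1, x.2); rewrite // inE.
    rewrite bsupp_triangle /= !subUset !sub1set vD !inE eqxx /=.
    by move: xW; rewrite !inE => /and3P[/andP[_ ->] /andP[_ ->]].
rewrite (eq_bigl (mem (S0 :|: S1 :|: S2 :|: S3))); last first.
  by move=> q; rewrite /= -dec !inE andbA.
have single w w' (p : V * V) : [set (w, w')] = [set p] -> w = p.1 /\ w' = p.2.
  by move/set1_inj => <-.
have d3 : [disjoint S0 :|: S1 :|: S2 & S3].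
  rewrite disjoint_sym disjoints_subset; apply/subsetP=> _ /imsetP[x /WP xu ->].
  rewrite in_setC; apply/negP=> h.
  suff : #|triangle (v, x.1, x.2)| = 1 by rewrite tri3.
  move: h; rewrite !in_setU => /orP[/orP[/set1P->|/imsetP[w _ ->]]|/imsetP[w _ ->]]; exact: cards1.
have d2 : [disjoint S0 :|: S1 & S2].
  rewrite disjoint_sym disjoints_subset; apply/subsetP=> q /imsetP[x].
  rewrite !in_setD1 => /andP[xv _] ->; rewrite in_setC; apply/negP; rewrite !in_setU.
  case/orP=> [/set1P/single/= [E _]|/imsetP[w _ /single/= [E _]]]; by rewrite E eqxx in xv.
have d1 : [disjoint S0 & S1].
  rewrite disjoint_sym disjoints_subset; apply/subsetP=> q /imsetP[x].
  rewrite !in_setD1 => /andP[xv _] ->; rewrite in_setC; apply/negP.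
  by move=> /set1P/single/= [_ E]; rewrite E eqxx in xv.
rewrite (bigID (mem S3)) /= addnC (eq_bigl (mem (S0 :|: S1 :|: S2))); last first.
  move=> q /=; rewrite [in LHS]in_setU; case: (boolP (q \in S3)) => q3; last by rewrite orbF andbT.
  by rewrite (disjointFl d3 q3) andbF.
rewrite [X in _ + X](eq_bigl (mem S3)); last first.
  by move=> q /=; rewrite [in LHS]in_setU; case: (q \in S3); rewrite ?orbT ?andbF.
rewrite (bigID (mem S2)) /= [X in X + _]addnC (eq_bigl (mem (S0 :|: S1))); last first.
  move=> q /=; rewrite [in LHS]in_setU; case: (boolP (q \in S2)) => q3; last by rewrite orbF andbT.
  by rewrite (disjointFl d2 q3) andbF.
rewrite [X in _ + X + _](eq_bigl (mem S2)); last first.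
  by move=> q /=; rewrite [in LHS]in_setU; case: (q \in S2); rewrite ?orbT ?andbF.
rewrite (bigID (mem S1)) /= [X in X + _ + _]addnC (eq_bigl (mem S0)); last first.
  move=> q /=; rewrite [in LHS]in_setU; case: (boolP (q \in S1)) => q3; last by rewrite orbF andbT.
  by rewrite (disjointFl d1 q3) andbF.
rewrite [X in _ + X + _ + _](eq_bigl (mem S1)); last first.
  by move=> q /=; rewrite [in LHS]in_setU; case: (q \in S1); rewrite ?orbT ?andbF.
have cE w : w \in D :\ v -> #|b_packings (D :\: [set v; w])| = b_count #|D :\ v|.-1.
  move=> wDv; have E : D :\: [set v; w] = (D :\ v) :\ w by rewrite setDDl.
  have E' : #|D :\ v| = #|(D :\ v) :\ w|.+1 by rewrite (cardsD1 w) wDv.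
  by rewrite E IH ?E' // -ltnS -E' -DE ltnW.
rewrite big_set1 bsupp1 /ends setUid IH; last by rewrite DE in Dn.
rewrite DE b_countS; congr (_ + _ ); [rewrite -addnA; congr (_ + _)|].
  rewrite !big_imset /=; [|by move=> w w' _ _ /single/= []..].
  under eq_bigr do rewrite bsupp1 /ends /=.
  under [X in _ + X]eq_bigr do rewrite bsupp1 /ends /= setUC.
  rewrite (eq_bigr (fun _ => b_count #|D :\ v|.-1)) => [|w]; last exact: cE.
  rewrite sum_nat_const; lia.
rewrite big_imset /=; last first.
  move=> x y /WP xu /WP yu; case: x xu => x1 x2 xu; case: y yu => y1 y2 yu /=.
  exact: triangle_inj.
rewrite (eq_bigr (fun _ => b_count #|D :\ v|.-2)); last first.
  move=> x xW; rewrite bsupp_triangle /=.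
  have E : D :\: [set v; x.1; x.2] = ((D :\ v) :\ x.1) :\ x.2 by rewrite !setDDl setUA.
  have x1D : x.1 \in D :\ v by move: xW; rewrite inE => /and3P[].
  have x2D : x.2 \in (D :\ v) :\ x.1.
    by move: xW; rewrite inE => /and3P[_ h1 h2]; rewrite in_setD1 h1 eq_sym h2.
  have E1 : #|D :\ v| = #|(D :\ v) :\ x.1|.+1 by rewrite (cardsD1 x.1) x1D.
  have E2 : #|(D :\ v) :\ x.1| = #|((D :\ v) :\ x.1) :\ x.2|.+1 by rewrite (cardsD1 x.2) x2D.
  by rewrite E E1 E2 /= IH //; lia.
rewrite sum_nat_const; congr (_ * _).
rewrite -sum1_card (eq_bigl (fun x => (x.1 \in D :\ v) && (x.2 \in (D :\ v) :\ x.1))); last first.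
  by move=> x; rewrite inE [x.2 \in _ :\ x.1]in_setD1 (eq_sym x.2 x.1); congr (_ && _); rewrite andbC.
rewrite -(pair_big_dep (fun x => x \in D :\ v) (fun x y => y \in (D :\ v) :\ x) (fun _ _ => 1)) /=.
rewrite (eq_bigr (fun _ => #|D :\ v|.-1)) ?sum_nat_const // => x xD.
by rewrite sum1_card [in RHS](cardsD1 x) xD.
Qed.

Lemma a_loop_blocks_sub : a_loop_blocks \subset a_blocks.
Proof. by apply/subsetP=> _ /imsetP[v _ ->]; rewrite inE cards1. Qed.

Lemma b_loop_blocks_sub : b_loop_blocks \subset b_blocks.
Proof. by rewrite /b_blocks -setUA subsetUl. Qed.

Lemma b_edge_blocks_sub : b_edge_blocks \subset b_blocks.
Proof. by rewrite /b_blocks setUAC subsetUr. Qed.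

Lemma a_loop_ffact j D : \sum_(P in a_packings D) #|P :&: a_loop_blocks| ^_ j =
  #|D| ^_ j * a_count (#|D| - j).
Proof.
rewrite (sum_packings_ffact a_blocks_neq0 (s := 1) (x := a_count) (m := id)).
- by rewrite mul1n ffact_prod; under eq_bigr do rewrite mul1n.
- exact: a_loop_blocks_sub.
- by move=> _ /imsetP[v _ ->]; rewrite cards1.
- exact: card_a_packings.
move=> D'; rewrite -[RHS](card_imset (mem D') (@set1_inj V)); apply: eq_card => p.
rewrite inE; apply/andP/imsetP=> [[/imsetP[v _ ->]]|[v vD ->]]; last by rewrite sub1set imset_f.
by rewrite sub1set; exists v.
Qed.

Lemma b_loop_ffact j D : \sum_(Q in b_packings D) #|Q :&: b_loop_blocks| ^_ j =
  #|D| ^_ j * b_count (#|D| - j).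
Proof.
rewrite (sum_packings_ffact b_blocks_neq0 (s := 1) (x := b_count) (m := id)).
- by rewrite mul1n ffact_prod; under eq_bigr do rewrite mul1n.
- exact: b_loop_blocks_sub.
- by move=> _ /imsetP[v _ ->]; rewrite bsupp1 /ends setUid cards1.
- exact: card_b_packings.
move=> D'; have inj : injective (fun v : V => [set (v, v)]) by move=> v w /set1_inj[].
rewrite -[RHS](card_imset (mem D') inj); apply: eq_card => p.
rewrite inE; apply/andP/imsetP=> [[/imsetP[v _ ->]]|[v vD ->]].
  by rewrite bsupp1 /ends setUid sub1set; exists v.
by rewrite bsupp1 /ends setUid sub1set imset_f.
Qed.

Lemma b_edge_ffact j D : \sum_(Q in b_packings D) #|Q :&: b_edge_blocks| ^_ j =
  #|D| ^_ (2 * j) * b_count (#|D| - 2 * j).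
Proof.
rewrite (sum_packings_ffact b_blocks_neq0 (s := 2) (x := b_count) (m := fun n => n * n.-1)).
(* Each extracted edge uses two vertices, and the products d(d-1) with d decreasing by 2 join into a
   single falling factorial of order 2j. *)
- congr (_ * _); elim: j => [|j IH]; first by rewrite big_ord0 muln0 ffactn0.
  rewrite big_ord_recr /= IH mulnS addnC addn2 !ffactnSr -mulnA; congr (_ * (_ * _)).
  by rewrite subnS.
- exact: b_edge_blocks_sub.
- by move=> q /imsetP[e]; rewrite inE => ee ->; rewrite bsupp1 /ends cards2 ee.
- exact: card_b_packings.
move=> D'; pose W := [set x : V * V | (x.1 \in D') && (x.2 \in D' :\ x.1)].
transitivity #|W|; last first.
  rewrite -sum1_card (eq_bigl (fun x => (x.1 \in D') && (x.2 \in D' :\ x.1))); last by move=> x; rewrite inE.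
  rewrite -(pair_big_dep (fun x => x \in D') (fun x y => y \in D' :\ x) (fun _ _ => 1)) /=.
  rewrite (eq_bigr (fun _ => #|D'|.-1)) ?sum_nat_const // => x xD.
  by rewrite sum1_card [in RHS](cardsD1 x) xD.
rewrite -[RHS](card_imset (mem W) (@set1_inj (V * V)%type)); apply: eq_card => p.
rewrite inE; apply/andP/imsetP=> [[/imsetP[e]]|[e]].
  rewrite inE => ee ->; rewrite bsupp1 /ends subUset !sub1set => /andP[h1 h2].
  by exists e; rewrite // !inE h1 h2 eq_sym ee.
rewrite !inE => /and3P[h1 h2 h3] ->; rewrite bsupp1 /ends subUset !sub1set h1 h3.
by split=> //; apply/imsetP; exists e; rewrite // inE eq_sym.
Qed.

End Blocks.
Notation a_packings := (packings (@id {set _}) (a_blocks _)).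
Notation b_packings := (packings (@bsupp _) (b_blocks _)).

(** * Graphs as pairs of packings *)

Section GraphsOfPackings.
Variable V : finType.
Implicit Types (D A : {set V}) (u v w : V) (e f : V * V) (q : {set V * V}) (G : graph V).
Implicit Types (P : {set {set V}}) (Q : {set {set V * V}}).

Definition graph_of_packings P Q : graph V := Graph setT P (cover Q).

Lemma bsuppP q v : reflect (exists2 e, e \in q & (v == e.1) || (v == e.2)) (v \in bsupp q).
Proof.
apply: (iffP bigcupP) => -[e eq]; first by rewrite in_set2; exists e.
by exists e => //; rewrite in_set2.
Qed.

Lemma touch_bsupp q e f : e \in q -> ~~ [disjoint ends e & ends f] -> ~~ [disjoint ends f & bsupp q].
Proof.
move=> eq /pred0Pn[x /andP[/= xe xf]]; apply/pred0Pn; exists x; apply/andP; split=> //=.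
by apply/bigcupP; exists e.
Qed.

Lemma touchP e f : reflect (exists2 x, (x == e.1) || (x == e.2) & (x == f.1) || (x == f.2))
  (~~ [disjoint ends e & ends f]).
Proof.
apply: (iffP pred0Pn) => -[x]; rewrite /= ?in_set2; first by case/andP; exists x.
by move=> h1 h2; exists x; rewrite /= !in_set2 h1.
Qed.

Lemma b_block_touch q e f : q \in b_blocks V -> e \in q -> f \in q -> ~~ [disjoint ends e & ends f].
Proof.
move=> qb eq fq; apply/touchP; case/b_blockP: qb => [v|g|[[x y] z]] qE; subst q.
- by move: eq fq => /set1P-> /set1P->; exists v; rewrite /= eqxx.
- by move: eq fq => /set1P-> /set1P->; exists g.1; rewrite /= eqxx.
move: eq fq; rewrite !inE /= => /orP[/orP[]|] /eqP-> /orP[/orP[]|] /eqP-> _ /=;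
  (by exists x; rewrite eqxx ?orbT) || (by exists y; rewrite eqxx ?orbT) || (by exists z; rewrite eqxx ?orbT).
Qed.

Lemma b_block_inj q e f : q \in b_blocks V -> e \in q -> f \in q -> (e.1 == f.1) = (e.2 == f.2).
Proof.
move=> qb eq fq; case/b_blockP: qb => [v|g|[[x y] z]] qE; subst q.
- by move: eq fq => /set1P-> /set1P->; rewrite !eqxx.
- by move: eq fq => /set1P-> /set1P->; rewrite !eqxx.
rewrite /= !inE !negb_or andbT => /andP[/andP[/negbTE xy /negbTE xz] /negbTE yz].
by move: eq fq; rewrite !inE /= => /orP[/orP[]|] /eqP-> /orP[/orP[]|] /eqP-> /=;
  rewrite ?eqxx ?xy ?xz ?yz ?(eq_sym y x) ?(eq_sym z x) ?(eq_sym z y) ?xy ?xz ?yz.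
Qed.

Lemma b_block_adjacent q x y : q \in b_blocks V -> x \in bsupp q -> y \in bsupp q ->
  [|| x == y, (x, y) \in q | (y, x) \in q].
Proof.
case/b_blockP=> [v|g|[[a b] c]] -> => [|_|_]; rewrite ?bsupp1 ?bsupp_triangle /ends ?inE /=.
- by rewrite !orbb => /eqP-> /eqP->; rewrite eqxx.
- by case: g => a b /=; move=> /orP[]/eqP-> /orP[]/eqP->; rewrite eqxx ?orbT.
by move=> /orP[/orP[]|] /eqP-> /orP[/orP[]|] /eqP->; rewrite ?eqxx ?orbT.
Qed.

(** Distinct blocks of a packing share no vertex, so the edges that touch a block are its own. *)
Lemma b_packing_block D Q e q : Q \in b_packings D -> e \in cover Q -> q \in Q ->
  ~~ [disjoint ends e & bsupp q] -> e \in q.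
Proof.
move=> QP /bigcupP[q' q'Q eq'] qQ /pred0Pn[x /andP[/= xe xq]].
suff -> : q = q' by [].
by apply: (packing_block_uniq QP qQ q'Q xq); apply/bigcupP; exists e.
Qed.

(** A block is recovered from any one of its edges as the set of all covered edges that touch it.
    This makes the passage from pairs of packings to graphs injective. *)
Lemma cover_packing_inj D : {in b_packings D &, injective (@cover (V * V)%type)}.
Proof.
suff sub Q Q' : Q \in b_packings D -> Q' \in b_packings D -> cover Q = cover Q' -> Q \subset Q'.
  by move=> Q Q' QP QP' E; apply/eqP; rewrite eqEsubset !sub.
have half Q1 Q2 q1 q2 e : Q1 \in b_packings D -> Q2 \in b_packings D -> cover Q1 = cover Q2 ->
    q1 \in Q1 -> q2 \in Q2 -> e \in q1 -> e \in q2 -> q2 \subset q1.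
  move=> QP1 QP2 E qQ1 qQ2 eq1 eq2; apply/subsetP=> f fq2.
  apply: (b_packing_block QP1) => //; first by rewrite E; apply/bigcupP; exists q2.
  apply: (touch_bsupp eq1); apply: (b_block_touch _ eq2 fq2).
  by case/packingsP: QP2 => /subsetP/(_ _ qQ2).
move=> QP QP' E; apply/subsetP=> q qQ.
have qb : q \in b_blocks V by case/packingsP: QP => /subsetP/(_ _ qQ).
have /set0Pn[x /bsuppP[e eq _]] := b_blocks_neq0 qb.
have : e \in cover Q' by rewrite -E; apply/bigcupP; exists q.
case/bigcupP=> q' q'Q eq'; suff -> : q = q' by [].
apply/eqP; rewrite eqEsubset; apply/andP; split.
  exact: (half Q' Q _ _ e).
exact: (half Q Q' _ _ e).
Qed.

Lemma potential_graph_of_packings P Q :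
  P \in a_packings setT -> Q \in b_packings setT ->
  potential (graph_of_packings P Q) <=
  4 * #|Q :&: b_loop_blocks V| + 3 * #|P :&: a_loop_blocks V| + 2 * #|Q :&: b_edge_blocks V|.
Proof.
move=> PP QP; rewrite /potential; apply: leq_add; [apply: leq_add|]; rewrite leq_mul2l /=.
- have inj : injective (fun v : V => [set (v, v)]) by move=> v w /set1_inj[].
  rewrite -(card_imset _ inj); apply: subset_leq_card; apply/subsetP=> _ /imsetP[v + ->].
  rewrite !inE /= => /bigcupP[q qQ vq].
  have qb : q \in b_blocks V by case/packingsP: QP => /subsetP/(_ _ qQ).
  suff qE : q = [set (v, v)] by rewrite -qE qQ /= qE imset_f.
  case/b_blockP: (qb) => [w|e|[[x y] z]] qE; rewrite qE in vq.
  + by case/set1P: vq => E _; rewrite qE E.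
  + by move/set1P: vq => <-; rewrite eqxx.
  move: vq; rewrite /= !inE !xpair_eqE /= !negb_or => /orP[/orP[]|] /andP[/eqP<- /eqP->];
  by rewrite eqxx ?andbF.
- rewrite -(card_imset _ (@set1_inj V)); apply: subset_leq_card; apply/subsetP=> _ /imsetP[v + ->].
  by rewrite !inE /= => -> ; rewrite imset_f.
rewrite -(card_imset _ (@set1_inj (V * V)%type)); apply: subset_leq_card; apply/subsetP=> _ /imsetP[e + ->].
rewrite inE => /isolatedP[ee eQ iso]; rewrite inE.
have /bigcupP[q qQ eq] : e \in cover Q := eQ.
have qb : q \in b_blocks V by case/packingsP: QP => /subsetP/(_ _ qQ).
suff qE : q = [set e].
  by rewrite -qE qQ qE /=; apply/imsetP; exists e; rewrite // inE.
apply/setP=> f; rewrite in_set1; apply/idP/eqP=> [fq|->//].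
apply/eqP/negPn/negP=> fe.
have fQ : f \in cover Q by apply/bigcupP; exists q.
have := iso f fQ fe; have /touchP[x] := b_block_touch qb fq eq.
by rewrite !inE => /orP[]/eqP<- ->; rewrite ?andbF.
Qed.

Lemma cover_mult_card (E : finType) (supp : E -> {set V}) (T : {set E}) v :
  cover_mult supp T v = #|[set t in T | v \in supp t]|.
Proof.
rewrite /cover_mult -sum1_card big_mkcond [RHS]big_mkcond; apply: eq_bigr => t _.
by rewrite inE; case: (t \in T) => //=; case: (v \in supp t).
Qed.

Lemma a_edges_packing G : a_edges_ok G -> (forall u, a_adjacent G u) ->
  aedges G \in a_packings setT.
Proof.
move=> /andP[/forallP a1 /forallP a2] adj; apply/packingsP; split.
  by apply/subsetP=> p pG; have := a1 p; rewrite pG inE => /andP[].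
move=> v; apply/eqP; rewrite inE cover_mult_card eqn_leq a2 /= card_gt0.
by have /existsP[p /andP[pG vp]] := adj v; apply/set0Pn; exists p; rewrite inE pG.
Qed.

(** The packing consists of the blocks of b-edges that contain every b-edge touching their support.
    The three admissible types of b-edges put each edge into such a closed block, and two closed
    blocks with a common vertex contain each other. *)
Lemma b_edges_packing G : b_edges_ok G -> (forall u, b_adjacent G u) ->
  exists2 Q, Q \in b_packings setT & bedges G = cover Q.
Proof.
case/and3P=> _ /b_partial_injectionP inj /forallP ok adj.
pose closed q := [forall f in bedges G, ~~ [disjoint ends f & bsupp q] ==> (f \in q)].
pose Q : {set {set V * V}} := [set q in b_blocks V | (q \subset bedges G) && closed q].
have closedP q f : closed q -> f \in bedges G -> ~~ [disjoint ends f & bsupp q] -> f \in q.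
  by move=> /forallP/(_ f)/implyP h fG; move/implyP: (h fG).
have inQ e : e \in bedges G -> exists2 q, q \in Q & e \in q.
  move=> eG; have := ok e; rewrite eG /= => /or3P[/eqP ee|iso|/existsP[w /and4P[u3 h1 h2 h3]]].
  - exists [set e]; last exact: set11.
    rewrite inE sub1set eG /=; apply/andP; split.
      rewrite !in_setU; apply/orP; left; apply/orP; left; apply/imsetP; exists e.1 => //.
      by case: (e) ee => ? ? /= ->.
    apply/forallP=> f; apply/implyP=> fG; rewrite bsupp1 in_set1; apply/implyP=> /touchP[x xf xe].
    have xE : x = e.1 by move: xe; rewrite -ee orbb => /eqP.
    have fe := inj _ _ fG eG.
    have h : f.1 = e.1 /\ f.2 = e.2.
      move: xf; rewrite xE => /orP[/eqP E|/eqP E].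
        by split=> //; apply/eqP; rewrite -fe E.
      by rewrite -E -ee; split=> //; apply/eqP; rewrite fe -E ee.
    by apply/eqP; case: (f) (e) h => ? ? [? ?] /= [-> ->].
  - have /isolatedP[ee _ far] := iso.
    exists [set e]; last exact: set11.
    rewrite inE sub1set eG /=; apply/andP; split.
      by rewrite !in_setU; apply/orP; left; apply/orP; right; apply/imsetP; exists e; rewrite // inE.
    apply/forallP=> f; apply/implyP=> fG; rewrite bsupp1 in_set1; apply/implyP=> /touchP[x xf xe].
    apply/negPn/negP=> fe; have /andP[n1 n2] := far f fG fe.
    move: n1 n2; rewrite !in_set2.
    by case/orP: xf => /eqP <-; rewrite xe.
  - have h1' : (e.1, e.2) \in triangle (e.1, e.2, w) by rewrite !inE eqxx.
    exists (triangle (e.1, e.2, w)); last by rewrite [e]surjective_pairing.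
    rewrite inE; apply/and3P; split.
    + by rewrite !in_setU; apply/orP; right; apply/imsetP; exists (e.1, e.2, w); rewrite // inE.
    + by rewrite !subUset !sub1set h1 h2 h3.
    apply/forallP=> f; apply/implyP=> fG; rewrite bsupp_triangle; apply/implyP=> /pred0Pn[x].
    rewrite /= !inE => /andP[xf xt].
    have e1 := inj _ _ fG h1; have e2 := inj _ _ fG h2; have e3 := inj _ _ fG h3.
    case: f {fG} e1 e2 e3 xf => y z /= e1 e2 e3 xf.
    rewrite !xpair_eqE -e1 -e2 -e3 !andbb.
    case/orP: xf => /eqP xE; rewrite xE in xt; first by [].
    by move: xt; rewrite -e1 -e2 -e3 -orbA orbC.
have QB : {subset Q <= b_blocks V} by move=> q; rewrite inE => /andP[].
have QG q : q \in Q -> {subset q <= bedges G} by rewrite inE => /and3P[_ /subsetP].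
have Qc q : q \in Q -> closed q by rewrite inE => /and3P[].
have coverQ : bedges G = cover Q.
  apply/setP=> e; apply/idP/bigcupP=> [/inQ[q qQ eq]|[q qQ eq]]; first by exists q.
  exact: QG eq.
exists Q => //; apply/packingsP; split; first exact/subsetP.
move=> v; rewrite inE; have /existsP[e /andP[eG ve]] := adj v.
have [q qQ eq] := inQ e eG.
have vq : v \in bsupp q by apply/bsuppP; exists e.
rewrite /cover_mult (big_setD1 q) //= vq big1 // => q'; rewrite in_setD1 => /andP[q'q q'Q].
apply/eqP; rewrite eqb0; apply/negP=> vq'; case/eqP: q'q.
have half q1 q2 : q1 \in Q -> q2 \in Q -> v \in bsupp q1 -> v \in bsupp q2 -> q1 \subset q2.
  move=> qQ1 qQ2 vq1 vq2; have /bsuppP[f fq1 vf] := vq1.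
  have fq2 : f \in q2.
    apply: (closedP _ _ (Qc _ qQ2) (QG _ qQ1 _ fq1)); apply/pred0Pn; exists v.
    by rewrite /= in_set2 vf.
  apply/subsetP=> g gq1; apply: (closedP _ _ (Qc _ qQ2) (QG _ qQ1 _ gq1)).
  exact: touch_bsupp fq2 (b_block_touch (QB _ qQ1) fq1 gq1).
by apply/eqP; rewrite eqEsubset !half.
Qed.

Definition packings_connected P Q :=
  [forall A : {set V}, invariant id P A && invariant (@bsupp V) Q A ==>
     (A == set0) || (A == setT)].

(** The set of vertices reachable from [u] is invariant and contains [u], hence is everything. *)
Lemma graph_of_packings_connected P Q : P \in a_packings setT -> Q \in b_packings setT ->
  packings_connected P Q -> connected_graph (graph_of_packings P Q).
Proof.
move=> PP QP /forallP conn.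
apply/forallP=> u; apply/implyP=> _; apply/forallP=> v; apply/implyP=> _.
set G := graph_of_packings P Q.
pose A := [set x | connect (neighbours G) u x].
have step x y : x \in A -> neighbours G x y -> y \in A.
  by rewrite !inE => ux xy; apply: connect_trans ux (connect1 xy).
have /implyP := conn A; have -> : invariant id P A && invariant (@bsupp V) Q A.
  apply/andP; split.
    apply/forallP=> p; apply/implyP=> pP; apply/orP.
    case: (boolP [disjoint p & A]) => [|/pred0Pn[x /andP[/= xp xA]]]; [by right|left]; apply/subsetP=> y yp.
    have [<-//|xy] := eqVneq x y; apply: (step x) => //.
    have pb : #|p| <= 2 by case/packingsP: PP => /subsetP/(_ _ pP); rewrite inE => /andP[].
    have pE : [set x; y] = p by apply/eqP; rewrite eqEcard subUset !sub1set xp yp cards2 xy.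
    by rewrite /neighbours /= pE pP.
  apply/forallP=> q; apply/implyP=> qQ; apply/orP.
  case: (boolP [disjoint bsupp q & A]) => [|/pred0Pn[x /andP[/= xq xA]]]; [by right|left]; apply/subsetP=> y yq.
  have qb : q \in b_blocks V by case/packingsP: QP => /subsetP/(_ _ qQ).
  have [<-//|xy] := eqVneq x y; apply: (step x) => //.
  have := b_block_adjacent qb xq yq; rewrite (negbTE xy) /= => h.
  apply/orP; right; case/orP: h => h; apply/orP; [left|right]; apply/bigcupP; exists q => //.
move=> /(_ isT) /orP[/eqP A0|/eqP AT]; last by have := in_setT v; rewrite -AT inE.
by have : u \in A by [rewrite inE connect0]; rewrite A0 inE.
Qed.

Lemma rooted_reduced_graph_of_packings P Q v :
  P \in a_packings setT -> Q \in b_packings setT -> packings_connected P Q ->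
  rooted_reduced (graph_of_packings P Q) v.
Proof.
move=> PP QP conn; apply/and3P; split; last 2 first.
- by rewrite inE.
- apply/forallP=> u; apply/implyP=> _; apply/implyP=> _; apply/andP; split.
    have [p pP up] := packing_cover PP (in_setT u).
    by apply/existsP; exists p; rewrite pP.
  have [q qQ /bsuppP[e eq ue]] := packing_cover QP (in_setT u).
  by apply/existsP; exists e; rewrite ue andbT; apply/bigcupP; exists q.
have Qb q : q \in Q -> q \in b_blocks V by case/packingsP: QP => /subsetP + _; apply.
apply/and4P; split; last exact: graph_of_packings_connected.
- by apply/set0Pn; exists v; rewrite inE.
- case/packingsP: PP => /subsetP PB h; apply/andP; split.
    by apply/forallP=> p; apply/implyP=> /PB; rewrite inE subsetT.
  by apply/forallP=> u; rewrite -(cover_mult_card id) h inE.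
apply/and3P; split.
- by apply/forallP=> e; rewrite /= !in_setT implybT.
- apply/b_partial_injectionP=> e f eQ fQ.
  have /bigcupP[q qQ eq] : e \in cover Q := eQ.
  have same : ~~ [disjoint ends f & ends e] -> (e.1 == f.1) = (e.2 == f.2).
    move=> tch; apply: (b_block_inj (Qb _ qQ)) => //.
    apply: (b_packing_block QP) => //; apply: (touch_bsupp eq).
    by rewrite disjoint_sym.
  apply/idP/idP=> /eqP E.
    have tch : ~~ [disjoint ends f & ends e] by apply/touchP; exists e.1; rewrite ?E eqxx.
    by rewrite -(same tch) E.
  have tch : ~~ [disjoint ends f & ends e] by apply/touchP; exists e.2; rewrite ?E eqxx orbT.
  by rewrite (same tch) E.
apply/forallP=> e; apply/implyP=> eQ; have /bigcupP[q qQ eq] : e \in cover Q := eQ.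
case/b_blockP: (Qb _ qQ) => [w|g|t] qE.
- by move: eq; rewrite qE => /set1P->; rewrite eqxx.
- move: eq; rewrite qE => /set1P ->  gg; apply/or3P; constructor 2.
  apply/isolatedP; split=> //.
    by apply/bigcupP; exists q; rewrite // qE set11.
  move=> f fQ fg; rewrite -negb_or; apply/negP=> fD; case/eqP: fg.
  have : f \in q.
    apply: (b_packing_block QP) => //; rewrite qE bsupp1; apply/touchP.
    move: fD; rewrite !in_set2 => /orP[h|h]; [exists f.1|exists f.2]; rewrite ?eqxx ?orbT //.
  by rewrite qE => /set1P.
move=> t3; apply/or3P; constructor 3; apply/existsP.
have tQ : {subset triangle t <= cover Q} by move=> f ft; apply/bigcupP; exists q; rewrite // qE.
move: t3 eq tQ; rewrite qE; case: t {qE} => -[x y] z /=.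
rewrite !inE negb_or andbT => /andP[/andP[xy xz] yz] et tQ.
have i1 : (x, y) \in cover Q by apply: tQ; rewrite !inE eqxx.
have i2 : (y, z) \in cover Q by apply: tQ; rewrite !inE eqxx orbT.
have i3 : (z, x) \in cover Q by apply: tQ; rewrite !inE eqxx orbT.
case/orP: et => [/orP[]|] /eqP->; [exists z|exists x|exists y];
  by rewrite /b_triangle /= !inE !negb_or i1 i2 i3 ?(eq_sym y x) ?(eq_sym z x) ?(eq_sym z y) xy xz yz.
Qed.

(** The added loops fill the only possible gaps, which are at the root. The resulting pair serves an
    upper bound over all pairs, so the conclusion does not record connectedness. *)
Lemma forget_root_packings G v : verts G = setT -> rooted_reduced G v ->
  b_partial_injection (forget_root G v) /\
  exists2 PQ, (PQ.1 \in a_packings setT) && (PQ.2 \in b_packings setT) &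
    forget_root G v = graph_of_packings PQ.1 PQ.2.
Proof.
move=> GT /and3P[/and4P[_ aok bok _] _ /forallP red].
have redP u : u != v -> a_adjacent G u /\ b_adjacent G u.
  by move=> uv; have := red u; rewrite GT in_setT uv /= => /andP[].
set G1 := if a_adjacent G v then G else add_a G [set v].
have G1T : verts G1 = setT by rewrite /G1; case: ifP.
have G1b : bedges G1 = bedges G by rewrite /G1; case: ifP.
have G1a : aedges G1 \in a_packings setT.
  rewrite /G1; case: ifP => [av|nav]; apply: a_edges_packing => //.
  - by move=> u; have [->//|/redP[]] := eqVneq u v.
  - have nv p : p \in aedges G -> v \notin p.
      move=> pG; apply/negP=> vp.
      have : a_adjacent G v by apply/existsP; exists p; rewrite pG.
      by rewrite nav.
    case/andP: aok => /forallP a1 /forallP a2; apply/andP; split; apply/forallP=> x.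
      apply/implyP=> /setU1P[->|xG]; first by rewrite /= cards1 GT subsetT.
      by have := a1 x; rewrite xG.
    have [->|xv] := eqVneq x v.
      rewrite -(cards1 [set v]); apply: subset_leq_card; apply/subsetP=> p.
      rewrite !inE => /andP[/orP[//|pG]] vp; case/negP: (nv p pG); exact: vp.
    apply: leq_trans (a2 x); apply: subset_leq_card; apply/subsetP=> p.
    rewrite !inE => /andP[/orP[/eqP->|->//]]; rewrite inE (negbTE xv) //.
  - move=> u; apply/existsP; have [->|/redP[/existsP[p /andP[pG up]] _]] := eqVneq u v.
      by exists [set v]; rewrite !inE !eqxx.
    by exists p; rewrite !inE pG orbT.
have G1ok : b_edges_ok G1 by rewrite /G1; case: ifP.
have G1adj u : b_adjacent G1 u = b_adjacent G u by rewrite /G1; case: ifP.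
have G2ok : b_edges_ok (forget_root G v).
  rewrite /forget_root -/G1; case: ifP => [//|nbv].
  have nv e : e \in bedges G -> (v != e.1) && (v != e.2).
    move=> eG; rewrite -negb_or; apply/negP=> ve; 
    have : b_adjacent G1 v by apply/existsP; exists e; rewrite G1b eG.
    by rewrite G1adj nbv.
  case/and3P: bok => /forallP b1 /b_partial_injectionP inj /forallP b3; apply/and3P; split.
  - by apply/forallP=> e; rewrite /= G1T !in_setT implybT.
  - apply/b_partial_injectionP=> e f /=; rewrite G1b => /setU1P[->|eG] /setU1P[->|fG] /=.
    + by rewrite !eqxx.
    + by have /andP[/negbTE-> /negbTE->] := nv f fG.
    + by have := nv e eG; rewrite !(eq_sym v) => /andP[/negbTE-> /negbTE->].
    exact: inj.
  apply/forallP=> e; apply/implyP=> /=; rewrite G1b => /setU1P[->|eG]; first by rewrite eqxx.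
  have := b3 e; rewrite eG /= => /or3P[->//|iso|/existsP[w /and4P[u3 h1 h2 h3]]]; apply/or3P.
    constructor 2; case/isolatedP: iso => ee _ far; apply/isolatedP; split=> //.
      by rewrite /= G1b in_setU1 eG orbT.
    move=> f; rewrite /= G1b => /setU1P[-> _|]; last exact: far.
    by rewrite /= in_set2 negb_or nv.
  constructor 3; apply/existsP; exists w.
  by rewrite /b_triangle u3 /= G1b !in_setU1 h1 h2 h3 !orbT.
have G2adj u : b_adjacent (forget_root G v) u.
  rewrite /forget_root -/G1; case: ifP => [bv|nbv].
    by rewrite G1adj; have [->//|/redP[]] := eqVneq u v.
  apply/existsP; have [->|/redP[_ /existsP[e /andP[eG ue]]]] := eqVneq u v.
    by exists (v, v); rewrite /= in_setU1 !eqxx.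
  by exists e; rewrite /= in_setU1 G1b eG orbT.
split; first by case/and3P: G2ok.
have [Q QP QE] := b_edges_packing G2ok G2adj.
exists (aedges G1, Q) => /=; first by rewrite G1a.
rewrite /graph_of_packings -QE -G1T /forget_root -/G1.
by case: ifP => _ //; case: (G1).
Qed.

(** The two booleans tell which loops were added at the root; an added loop was absent before, so
    deleting it restores the graph. *)
Lemma forget_root_inj :
  {in [pred x : graph V * V | (verts x.1 == setT)] &,
    injective (fun x => (forget_root x.1 x.2, x.2, a_adjacent x.1 x.2, b_adjacent x.1 x.2))}.
Proof.
move=> [G v] [H w]; rewrite !inE /= => /eqP GT /eqP HT [E0 Ew Ea Eb]; subst w; move: E0.
have naG K : ~~ a_adjacent K v -> aedges K = aedges (add_a K [set v]) :\ [set v].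
  move=> na; rewrite /= setU1K //; apply: contra na => vK; apply/existsP; exists [set v].
  by rewrite vK set11.
have nbG K : ~~ b_adjacent K v -> bedges K = bedges (add_b K (v, v)) :\ (v, v).
  move=> na; rewrite /= setU1K //; apply: contra na => vK; apply/existsP; exists (v, v).
  by rewrite vK eqxx.
rewrite /forget_root -Ea -Eb => E; congr (_, _).
have EA : aedges G = aedges H.
  case av: (a_adjacent G v) in E Ea.
    by have := congr1 (@aedges V) E; case: ifP.
  rewrite (naG G) ?av // (naG H) -?Ea //.
  by have := congr1 (@aedges V) E; case: ifP => _ /= ->.
have EB : bedges G = bedges H.
  case bv: (b_adjacent G v) in E Eb.
    by have := congr1 (@bedges V) E; case: ifP.
  rewrite (nbG G) ?bv // (nbG H) -?Eb //.
  by have := congr1 (@bedges V) E; case: ifP => _ /= ->.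
by case: G H GT HT EA EB {E Ea Eb} => ? ? ? [? ? ?] /= -> -> -> ->.
Qed.

End GraphsOfPackings.

(** * Counting rooted reduced graphs through pairs of packings *)

Definition split_count n k :=
  'C(n, k) * ((a_count k * a_count (n - k)) * (b_count k * b_count (n - k))).

Section Counting.
Variable V : finType.

Definition packing_pairs : {set {set {set V}} * {set {set V * V}}} :=
  setX (a_packings setT) (b_packings setT).

Lemma card_packing_pairs : #|packing_pairs| = a_count #|V| * b_count #|V|.
Proof. by rewrite cardsX card_a_packings card_b_packings cardsT. Qed.

(** A disconnected pair has a proper nonempty invariant set, and passing to the complement makes its
    size at most half of the vertices. [split_count] then bounds the number of choices of such a set
    of size k together with structures on both sides. *)
Lemma card_disconnected :
  #|[set x in packing_pairs | ~~ packings_connected x.1 x.2]| <=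
  \sum_(1 <= k < (#|V|./2).+1) split_count #|V| k.
Proof.
pose small (A : {set V}) := (A != set0) && (#|A| <= #|V|./2).
pose inv (x : {set {set V}} * {set {set V * V}}) (A : {set V}) :=
  invariant id x.1 A && invariant (@bsupp V) x.2 A.
have wit x : ~~ packings_connected x.1 x.2 -> exists2 A, small A & inv x A.
  rewrite negb_forall => /existsP[A]; rewrite negb_imply negb_or => /andP[iA /andP[A0 AT]].
  have cA := cardsC A.
  case: (leqP #|A| #|V|./2) => hA; [exists A => //; exact/andP | exists (~: A)].
    rewrite /small; apply/andP; split; last by lia.
    by rewrite -card_gt0; have := subset_leq_card (subsetT A); move: AT; rewrite eqEcard subsetT /= cardsT; lia.
  by rewrite /inv !invariantC.
apply: (@leq_trans (\sum_(A | small A) #|[set x in packing_pairs | inv x A]|)).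
  under [X in _ <= X]eq_bigr do rewrite -sum1_card big_mkcond.
  rewrite exchange_big -sum1_card big_mkcond /=; apply: leq_sum => x _.
  rewrite inE; case: ifP => // /andP[xP /wit[A sA iA]].
  by rewrite (bigD1 A) //= inE xP iA.
apply: (@leq_trans (\sum_(A | small A)
   (a_count #|A| * a_count (#|V| - #|A|)) * (b_count #|A| * b_count (#|V| - #|A|)))).
  apply: leq_sum => A _.
  apply: leq_trans (_ : #|setX [set P in a_packings setT | invariant id P A]
       [set Q in b_packings setT | invariant (@bsupp V) Q A]| <= _).
    apply: subset_leq_card; apply/subsetP=> -[P Q].
    rewrite in_set /inv /packing_pairs !in_setX !in_set /=.
    by case/andP=> /andP[/andP[-> ->] /andP[-> ->]] /andP[-> ->].
  have cA : #|~: A| = #|V| - #|A| by rewrite -(cardsC A) addKn.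
  rewrite cardsX; apply: leq_mul.
    have := card_packings_invariant (@id {set V}) (a_blocks V) A.
    by rewrite !card_a_packings cA.
  have := card_packings_invariant (@bsupp V) (b_blocks V) A.
  by rewrite !card_b_packings cA.
rewrite (eq_bigl (fun A : {set V} => (0 < #|A| < (#|V|./2).+1))); last first.
  by move=> A; rewrite /small card_gt0 ltnS.
rewrite big_add1 big_mkord /=.
have inI (A : {set V}) : 0 < #|A| < (#|V|./2).+1 -> #|A|.-1 < #|V|./2 by lia.
case hn: (#|V|./2) => [|h]; first by rewrite big_pred0 // => A; lia.
(* Sets are grouped by size; sizes start at 1, so the ordinal [k] stands for size [k.+1]. *)
rewrite (partition_big (fun A : {set V} => inord #|A|.-1 : 'I_h.+1) xpredT) //=.
apply: leq_sum => k _.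
rewrite (eq_bigl (fun A : {set V} => A \in [set A : {set V} | #|A| == k.+1])); last first.
  move=> A; rewrite inE; apply/andP/eqP=> [[Ah /eqP kE]|Ak].
    have := congr1 val kE; rewrite /= inordK; lia.
  split; first by rewrite Ak; have := ltn_ord k; lia.
  by rewrite Ak /= inord_val.
rewrite (eq_bigr (fun _ => (a_count k.+1 * a_count (#|V| - k.+1)) * (b_count k.+1 * b_count (#|V| - k.+1)))); last first.
  by move=> A; rewrite inE => /eqP->.
by rewrite sum_nat_const card_draws.
Qed.

End Counting.

(** Every connected pair gives a reduced graph whichever vertex is taken as root. Only this lower
    bound on the sample space is needed. *)
Lemma card_labeled_rooted_reduced n :
  n * (a_count n * b_count n) <= #|labeled_rooted_reduced n| +
     n * \sum_(1 <= k < n./2.+1) split_count n k.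
Proof.
pose T := [set x in packing_pairs 'I_n | packings_connected x.1 x.2].
have TE : a_count n * b_count n <= #|T| + \sum_(1 <= k < n./2.+1) split_count n k.
  have := card_disconnected 'I_n; have := card_packing_pairs 'I_n; rewrite card_ord => <- h.
  rewrite -(cardsID [set x | packings_connected x.1 x.2] (packing_pairs 'I_n)).
  apply: leq_add; first by apply: subset_leq_card; apply/subsetP=> x; rewrite !inE.
  by apply: leq_trans h; apply: subset_leq_card; apply/subsetP=> x; rewrite !inE andbC.
apply: (@leq_trans (n * (#|T| + \sum_(1 <= k < n./2.+1) split_count n k))); first exact: leq_mul.
rewrite mulnDr leq_add2r.
pose f (x : 'I_n * ({set {set 'I_n}} * {set {set 'I_n * 'I_n}})) := (graph_of_packings x.2.1 x.2.2, x.1).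
have -> : n * #|T| = #|setX [set: 'I_n] T| by rewrite cardsX cardsT card_ord.
have TP v P Q : ((v, (P, Q)) \in setX [set: 'I_n] T) =
    [&& P \in a_packings setT, Q \in b_packings setT & packings_connected P Q].
  by rewrite in_setX in_setT /T in_set /packing_pairs in_setX -andbA.
rewrite -(card_in_imset (f := f)); last first.
  move=> [v [P Q]] [w [P' Q']]; rewrite !TP.
  move=> /and3P[_ QP _] /and3P[_ QP' _] [-> E ->].
  by rewrite (cover_packing_inj QP QP' E).
apply: subset_leq_card; apply/subsetP=> _ /imsetP[[v [P Q]] + ->].
rewrite TP => /and3P[PP QP conn].
by rewrite in_set eqxx rooted_reduced_graph_of_packings.
Qed.

Lemma rooted_silh_size_potential n (x : graph 'I_n * 'I_n) :
  x \in labeled_rooted_reduced n ->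
  n <= rooted_silh_size x + potential (forget_root x.1 x.2).
Proof.
rewrite inE => /andP[/eqP xT red]; have [inj [PQ _ E]] := forget_root_packings xT red.
rewrite /rooted_silh_size /= cardsT card_ord.
apply: leq_trans (reduct_potential inj).
by rewrite E /= cardsT card_ord.
Qed.

Definition packing_potential (V : finType) (x : {set {set V}} * {set {set V * V}}) :=
  4 * #|x.2 :&: b_loop_blocks V| + 3 * #|x.1 :&: a_loop_blocks V| +
  2 * #|x.2 :&: b_edge_blocks V|.

(** The factor [4 * n] counts the roots and the two booleans of [forget_root_inj]. *)
Lemma card_potential_forget_root n m :
  #|[set x in labeled_rooted_reduced n | m <= potential (forget_root x.1 x.2)]| <=
  4 * n * #|[set x in packing_pairs 'I_n | m <= packing_potential x]|.
Proof.
set S := [set x in _ | _]; set T := [set x in packing_pairs _ | _].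
pose g (x : graph 'I_n * 'I_n) := (forget_root x.1 x.2, x.2, a_adjacent x.1 x.2, b_adjacent x.1 x.2).
pose h (y : {set {set 'I_n}} * {set {set 'I_n * 'I_n}} * 'I_n * bool * bool) :=
  (graph_of_packings y.1.1.1.1 y.1.1.1.2, y.1.1.2, y.1.2, y.2).
have -> : 4 * n * #|T| = #|setX (setX (setX T [set: 'I_n]) [set: bool]) [set: bool]|.
  by rewrite !cardsX !cardsT card_ord card_bool; lia.
rewrite -(card_in_imset (f := g)); last first.
  move=> x y; rewrite !inE => /andP[/andP[xT _] _] /andP[/andP[yT _] _].
  exact: forget_root_inj.
apply: leq_trans (leq_imset_card h _); apply: subset_leq_card; apply/subsetP=> _ /imsetP[x + ->].
rewrite !inE => /andP[/andP[/eqP xT red] xm].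
have [_ [[P Q] /andP[/= PP QP] E]] := forget_root_packings xT red.
apply/imsetP; exists ((P, Q), x.2, a_adjacent x.1 x.2, b_adjacent x.1 x.2).
  rewrite !in_setX !in_setT /= !andbT /T in_set /packing_pairs in_setX PP QP /=; apply: leq_trans xm _.
  by rewrite E; exact: potential_graph_of_packings.
by rewrite /g /h /= E.
Qed.

(** Markov's inequality applied to a falling factorial, which is monotone in its base. *)
Lemma card_ffact_markov (T : finType) (S : {set T}) (X : T -> nat) m j c :
  \sum_(x in S) X x ^_ j = c -> #|[set x in S | m <= X x]| * m ^_ j <= c.
Proof.
move=> <-; rewrite -sum1_card big_distrl /= big_mkcond [X in _ <= X]big_mkcond /=.
apply: leq_sum => x _; rewrite inE; case: (x \in S) => //=; case: ifP => // mX.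
rewrite mul1n !ffact_prod; apply: leq_prod => i _; exact: leq_sub2r.
Qed.

(** If all three counts stay below their thresholds, the potential is at most (4+3)(l-1) + 2(e-1) =
    7l + 2e - 9, which is less than m. *)
Lemma card_packing_potential_le n m l e : 7 * l + 2 * e <= m + 8 ->
  #|[set x in packing_pairs 'I_n | m <= packing_potential x]| <=
  a_count n * #|[set Q in b_packings [set: 'I_n] | e <= #|Q :&: b_edge_blocks 'I_n|]| +
  a_count n * #|[set Q in b_packings [set: 'I_n] | l <= #|Q :&: b_loop_blocks 'I_n|]| +
  #|[set P in a_packings [set: 'I_n] | l <= #|P :&: a_loop_blocks 'I_n|]| * b_count n.
Proof.
move=> hm; have cA : #|a_packings [set: 'I_n]| = a_count n by rewrite card_a_packings cardsT card_ord.
have cB : #|b_packings [set: 'I_n]| = b_count n by rewrite card_b_packings cardsT card_ord.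
rewrite -cA -cB -!cardsX.
set SE := [set Q in _ | e <= _]; set SB := [set Q in _ | l <= _]; set SA := [set P in _ | l <= _].
set X := setX _ SE; set Y := setX _ SB; set Z := setX SA _.
apply: (@leq_trans #|X :|: Y :|: Z|); last first.
  by rewrite (leq_trans (leq_card_setU _ _)) // leq_add2r leq_card_setU.
apply: subset_leq_card; apply/subsetP=> -[P Q].
rewrite in_set /packing_pairs in_setX => /andP[/andP[/= PP QQ]]; rewrite /packing_potential /= => hx.
rewrite !in_setU !in_setX PP QQ /= andbT.
have -> : (Q \in SE) = (e <= #|Q :&: b_edge_blocks 'I_n|) by rewrite /SE in_set QQ.
have -> : (Q \in SB) = (l <= #|Q :&: b_loop_blocks 'I_n|) by rewrite /SB in_set QQ.
have -> : (P \in SA) = (l <= #|P :&: a_loop_blocks 'I_n|) by rewrite /SA in_set PP.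
move: hx; move: #|_ :&: b_edge_blocks _| #|_ :&: b_loop_blocks _| #|_ :&: a_loop_blocks _|.
by clear -hm; lia.
Qed.

(** * Asymptotics *)

From mathcomp Require Import all_classical all_reals all_analysis.
From mathcomp Require Import ring lra.
Import Order.TTheory GRing.Theory Num.Theory numFieldNormedType.Exports.
Local Open Scope classical_set_scope.
Local Open Scope ring_scope.

Lemma expn_leq_ffact m r : ((m - r) ^ r <= m.-1 ^_ r)%N.
Proof.
rewrite ffact_prod -[X in (_ ^ X)%N]card_ord -prod_nat_const; apply: leq_prod => i _.
by have := ltn_ord i; lia.
Qed.

(** * Comparison of the counts with powers of factorials *)

Section Counts.
Variable R : realType.
Implicit Types (x : nat -> R) (y : R).

(* A convexity bound: it turns the bound on the factorial moment of order
   [r.+1] of the number of loops into a bound on its mean. *)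
Lemma ler_ffact (L r : nat) y : 0 < y -> L%:R <= r%:R + y + (L ^_ r.+1)%:R / y ^+ r.
Proof.
move=> y0; have h0 : 0 <= (L ^_ r.+1)%:R / y ^+ r by rewrite divr_ge0 ?ler0n ?exprn_ge0 ?ltW.
case: (leP L%:R (r%:R + y)) => [h|h]; first by rewrite (le_trans h) // lerDl.
apply: (@le_trans _ _ ((L ^_ r.+1)%:R / y ^+ r)); last first.
  by rewrite lerDr addr_ge0 // ltW.
rewrite ler_pdivlMr ?exprn_gt0 // ffactnS natrM ler_wpM2l //.
apply: le_trans (_ : ((L - r) ^ r)%:R <= _); last by rewrite ler_nat expn_leq_ffact.
have rL : (r <= L)%N by rewrite -(ler_nat R); lra.
by rewrite natrX natrB // lerXn2r ?nnegrE ?subr_ge0 ?ler_nat //; lra.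
Qed.

(** The last hypothesis is one term of the recurrence, the structures in which a given vertex lies
    on a largest block. It bounds the factorial moment of order r+1 by n times the number of
    structures, and [ler_ffact] turns this into a bound on the mean. *)
Lemma mean_ffact (T : finType) (S : {set T}) (X : T -> nat) (r n c1 cr : nat) y :
  0 < y ->
  (\sum_(t in S) X t ^_ 1 = n * c1)%N -> (\sum_(t in S) X t ^_ r.+1 = n ^_ r.+1 * cr)%N ->
  (n.-1 ^_ r * cr <= #|S|)%N ->
  n%:R * c1%:R <= (r%:R + y + n%:R / y ^+ r) * #|S|%:R :> R.
Proof.
move=> y0 h1 hr hS; rewrite -natrM -h1 natr_sum.
apply: le_trans (_ : \sum_(t in S) (r%:R + y + (X t ^_ r.+1)%:R / y ^+ r) <= _).
  by apply: ler_sum => t _; rewrite ffactn1; exact: ler_ffact.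
rewrite big_split /= -mulr_suml -natr_sum hr sumr_const -[X in X + _]mulr_natr.
rewrite [leRHS]mulrDl lerD2l mulrAC ler_wpM2r ?invr_ge0 ?exprn_ge0 ?(ltW y0) //.
by rewrite ffactnS -mulnA natrM ler_wpM2l // ler_nat.
Qed.

(** The left side is [a_count n] times the mean number of a-loops. The parameter [y] is left free so
    that it can be balanced afterwards. *)
Lemma a_count_pred n y : 0 < y -> (0 < n)%N ->
  n%:R * (a_count n.-1)%:R <= (1 + y + n%:R / y) * (a_count n)%:R :> R.
Proof.
move=> y0 n0; have card : #|a_packings [set: 'I_n]| = a_count n by rewrite card_a_packings cardsT card_ord.
have := @mean_ffact _ (a_packings [set: 'I_n]) (fun P => #|P :&: a_loop_blocks 'I_n|) 1 n
  (a_count n.-1) (a_count n.-2) y y0.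
rewrite card expr1; apply.
- by rewrite a_loop_ffact cardsT card_ord ffactn1 subn1.
- by rewrite a_loop_ffact cardsT card_ord subn2.
- by case: n n0 {card} => // n _; rewrite a_countS ffactn1 /= leq_addl.
Qed.

Lemma b_count_pred n y : 0 < y -> (0 < n)%N ->
  n%:R * (b_count n.-1)%:R <= (2 + y + n%:R / y ^+ 2) * (b_count n)%:R :> R.
Proof.
move=> y0 n0; have card : #|b_packings [set: 'I_n]| = b_count n by rewrite card_b_packings cardsT card_ord.
have := @mean_ffact _ (b_packings [set: 'I_n]) (fun P => #|P :&: b_loop_blocks 'I_n|) 2 n
  (b_count n.-1) (b_count (n - 3)) y y0.
rewrite card; apply.
- by rewrite b_loop_ffact cardsT card_ord ffactn1 subn1.
- by rewrite b_loop_ffact cardsT card_ord.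
case: n n0 {card} => // n _; rewrite b_countS /=.
by rewrite -[(n.+1 - 3)%N]/(n - 2)%N subn2 ffactnSr ffactn1 subn1 leq_addl.
Qed.

Lemma a_count_gt0 n : (0 < a_count n)%N.
Proof. by elim: n => // n IH; rewrite a_countS addn_gt0 IH. Qed.

Lemma b_count_gt0 n : (0 < b_count n)%N.
Proof. by elim: n => // n IH; rewrite b_countS !addn_gt0 IH. Qed.

(* [root6 n = n^(1/6)] and [rfact n = (n!)^(1/6)]; [a_count n] and [b_count n]
   are close to [(n!)^(1/2)] and [(n!)^(2/3)]. *)
Definition root6 n : R := n%:R `^ 6^-1.
Definition rfact n : R := \prod_(i < n) root6 i.+1.

Lemma root6X n : root6 n ^+ 6 = n%:R.
Proof. by rewrite /root6 -powR_mulrn ?powR_ge0 // -powRrM mulVf ?pnatr_eq0 // powRr1. Qed.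

Lemma root6_gt0 n : (0 < n)%N -> 0 < root6 n.
Proof. by move=> n0; rewrite powR_gt0 // ltr0n. Qed.

Lemma root6_ge1 n : (0 < n)%N -> 1 <= root6 n.
Proof.
by move=> n0; rewrite -(@ler_pXn2r _ 6) ?nnegrE ?powR_ge0 // root6X expr1n ler1n.
Qed.

Lemma rfactS n : rfact n.+1 = rfact n * root6 n.+1.
Proof. by rewrite /rfact big_ord_recr. Qed.

Lemma rfact_gt0 n : 0 < rfact n.
Proof. by apply: prodr_gt0 => i _; exact: root6_gt0. Qed.

Lemma rfactX n : rfact n ^+ 6 = n`!%:R.
Proof.
elim: n => [|n IH]; first by rewrite /rfact big_ord0 expr1n.
by rewrite rfactS exprMn IH root6X factS natrM mulrC.
Qed.

(** Normalised by the conjectural size (n!)^(1/2), and (n!)^(2/3) for [b_ratio], so that the leading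
    term of each recurrence gets a coefficient close to 1. *)
Definition a_ratio n : R := (a_count n)%:R / rfact n ^+ 3.
Definition b_ratio n : R := (b_count n)%:R / rfact n ^+ 4.

Lemma a_ratio_gt0 n : 0 < a_ratio n.
Proof. by rewrite divr_gt0 ?exprn_gt0 ?rfact_gt0 // ltr0n a_count_gt0. Qed.

Lemma b_ratio_gt0 n : 0 < b_ratio n.
Proof. by rewrite divr_gt0 ?exprn_gt0 ?rfact_gt0 // ltr0n b_count_gt0. Qed.

Lemma a_ratio_le_succ n : a_ratio n <= 3 * a_ratio n.+1.
Proof.
have c1 := root6_ge1 (ltn0Sn n); have cX := root6X n.+1; set c := root6 n.+1 in c1 cX.
have c0 : 0 < c by lra.
(* The balancing choice is y = (n+1)^(1/2), where the mean is at most 1 + 2y, hence at most 3y. *)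
have := @a_count_pred n.+1 (c ^+ 3) (exprn_gt0 _ c0) isT; rewrite -cX /= => h.
have h' : c ^+ 3 * (a_count n)%:R <= 3 * (a_count n.+1)%:R.
  have c3 : 1 <= c ^+ 3 by rewrite exprn_ege1.
  have E : c ^+ 6 / c ^+ 3 = c ^+ 3.
    by rewrite -[6%N]/(3 + 3)%N exprD mulfK // expf_neq0 // gt_eqF.
  rewrite E in h; rewrite -(ler_pM2l (exprn_gt0 3 c0)) mulrA -exprD -[(3 + 3)%N]/6%N.
  apply: le_trans h _; rewrite mulrA ler_wpM2r //; lra.
rewrite /a_ratio rfactS exprMn -/c ler_pdivrMr ?exprn_gt0 ?rfact_gt0 //.
rewrite -(ler_pM2l (exprn_gt0 3 c0)); apply: le_trans h' _.
rewrite le_eqVlt; apply/orP; left; apply/eqP; field.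
by rewrite !gt_eqF ?rfact_gt0.
Qed.

Lemma b_ratio_le_succ n : b_ratio n <= 4 * b_ratio n.+1.
Proof.
have c1 := root6_ge1 (ltn0Sn n); have cX := root6X n.+1; set c := root6 n.+1 in c1 cX.
have c0 : 0 < c by lra.
(* Here y = (n+1)^(1/3) balances the bound: 2 + 2y is at most 4y. *)
have := @b_count_pred n.+1 (c ^+ 2) (exprn_gt0 _ c0) isT; rewrite -cX /= => h.
have h' : c ^+ 4 * (b_count n)%:R <= 4 * (b_count n.+1)%:R.
  have c2 : 1 <= c ^+ 2 by rewrite exprn_ege1.
  have E : c ^+ 6 / (c ^+ 2) ^+ 2 = c ^+ 2.
    by rewrite -exprM -[6%N]/(2 + 2 * 2)%N exprD mulfK // expf_neq0 // gt_eqF.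
  rewrite E in h; rewrite -(ler_pM2l (exprn_gt0 2 c0)) mulrA -exprD -[(2 + 4)%N]/6%N.
  apply: le_trans h _; rewrite mulrA ler_wpM2r //; lra.
rewrite /b_ratio rfactS exprMn -/c ler_pdivrMr ?exprn_gt0 ?rfact_gt0 //.
rewrite -(ler_pM2l (exprn_gt0 4 c0)); apply: le_trans h' _.
rewrite le_eqVlt; apply/orP; left; apply/eqP; field.
by rewrite !gt_eqF ?rfact_gt0.
Qed.

(** Steps of length 2 lose no constant: the recurrence gives a factor n+2, which is at least
    ((n+1)(n+2))^(1/2). *)
Lemma a_ratio_le_add2 n : a_ratio n <= a_ratio n.+2.
Proof.
have r0 := rfact_gt0 n.
have c10 := root6_gt0 (ltn0Sn n); have c20 := root6_gt0 (ltn0Sn n.+1).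
have : (root6 n.+1 * root6 n.+2) ^+ 3 <= n.+2%:R.
  rewrite -(@ler_pXn2r _ 2) ?nnegrE ?exprn_ge0 ?mulr_ge0 ?(ltW c10) ?(ltW c20) // -exprM exprMn !root6X.
  by rewrite -natrM -natrX ler_nat expnS expn1 leq_mul2r leqnSn orbT.
have : n.+2%:R * (a_count n)%:R <= (a_count n.+2)%:R :> R.
  rewrite -natrM ler_nat a_countS /=.
  have : (a_count n <= a_count n.+1)%N by rewrite a_countS leq_addr.
  nia.
rewrite /a_ratio !rfactS.
set c1 := root6 n.+1 in c10 *; set c2 := root6 n.+2 in c20 *; set r := rfact n in r0 * => h1 h2.
rewrite ler_pdivlMr ?exprn_gt0 ?mulr_gt0 //; apply: le_trans h1.
rewrite [leLHS](_ : _ = (c1 * c2) ^+ 3 * (a_count n)%:R); last by field; rewrite gt_eqF.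
by rewrite ler_wpM2r.
Qed.

(** The recurrence gives a factor at least (n+2)^2, while (n+1)(n+3) is at most (n+2)^2, so that
    ((n+1)(n+2)(n+3))^(2/3) is at most (n+2)^2. *)
Lemma b_ratio_le_add3 n : b_ratio n <= b_ratio n.+3.
Proof.
have r0 := rfact_gt0 n.
have c10 := root6_gt0 (ltn0Sn n); have c20 := root6_gt0 (ltn0Sn n.+1).
have c30 := root6_gt0 (ltn0Sn n.+2).
have : (root6 n.+1 * root6 n.+2 * root6 n.+3) ^+ 4 <= n.+2%:R ^+ 2.
  rewrite -(@ler_pXn2r _ 3) ?nnegrE ?exprn_ge0 ?mulr_ge0 ?(ltW c10) ?(ltW c20) ?(ltW c30) // -!exprM.
  rewrite [(4 * 3)%N](_ : _ = (6 * 2)%N) // exprM [X in X ^+ 2]exprMn [X in (X * _) ^+ 2]exprMn !root6X.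
  rewrite -!natrM -!natrX ler_nat -[(2 * 3)%N]/(3 * 2)%N expnM leq_exp2r //.
  by rewrite !expnS expn0; nia.
have : n.+2%:R ^+ 2 * (b_count n)%:R <= (b_count n.+3)%:R :> R.
  rewrite -natrX -natrM ler_nat b_countS /=.
  have : (b_count n <= b_count n.+1)%N by rewrite b_countS -addnA leq_addr.
  rewrite !expnS expn0; nia.
rewrite /b_ratio !rfactS.
set c1 := root6 n.+1 in c10 *; set c2 := root6 n.+2 in c20 *; set c3 := root6 n.+3 in c30 *.
set r := rfact n in r0 * => h1 h2.
rewrite ler_pdivlMr ?exprn_gt0 ?mulr_gt0 //; apply: le_trans h1.
rewrite [leLHS](_ : _ = (c1 * c2 * c3) ^+ 4 * (b_count n)%:R); last by field; rewrite gt_eqF.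
by rewrite ler_wpM2r.
Qed.

(** Steps of length [p] are free and at most [p] single steps cost a factor [B] each, so the loss is
    bounded however far apart [m] and [n] are. *)
Lemma ratio_le (x : nat -> R) (B : R) p m n : (0 < p)%N -> 1 <= B -> (forall k, 0 <= x k) ->
  (forall k, x k <= B * x k.+1) -> (forall k, x k <= x (k + p)%N) ->
  (m <= n)%N -> x m <= B ^+ p * x n.
Proof.
move=> p0 B1 x0 xB xp mn; have B0 : 0 <= B by lra.
pose q := ((n - m) %/ p)%N; pose r := ((n - m) %% p)%N.
have nE : n = (m + r + q * p)%N by have := divn_eq (n - m) p; rewrite -/q -/r; lia.
have step1 k : x m <= B ^+ k * x (m + k)%N.
  elim: k => [|k IH]; first by rewrite mul1r addn0.
  by apply: le_trans IH _; rewrite exprSr -mulrA ler_wpM2l ?exprn_ge0 // addnS.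
have step2 k l : x l <= x (l + k * p)%N.
  elim: k => [|k IH]; first by rewrite addn0.
  by rewrite mulSnr addnA; exact: le_trans IH (xp _).
have rp : (r <= p)%N by rewrite ltnW // ltn_pmod.
apply: le_trans (step1 r) _.
apply: (@le_trans _ _ (B ^+ p * x (m + r)%N)).
  by rewrite ler_wpM2r // ler_weXn2l.
rewrite ler_wpM2l ?exprn_ge0 //.
by rewrite nE step2.
Qed.

End Counts.

(** * Rarity of disconnected pairs *)

Lemma leq_expn_bin n k : (k <= n)%N -> (n ^ k <= 'C(n, k) * k ^ k)%N.
Proof.
move=> kn; have : (n ^ k * k`! <= n ^_ k * k ^ k)%N.
  rewrite -(ffactnn k) !ffact_prod.
  have powE a : (a ^ k = \prod_(i < k) a)%N by rewrite prod_nat_const card_ord.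
  rewrite !powE -!big_split /=; apply: leq_prod => i _.
  by rewrite mulnBr mulnBl leq_sub2l // mulnC leq_mul.
by rewrite -bin_ffact mulnAC leq_pmul2r ?fact_gt0.
Qed.

Section Split.
Variable R : realType.
Implicit Types (x : nat -> R).
Notation root6 := (root6 R).
Notation rfact := (rfact R).
Notation a_ratio := (a_ratio R).
Notation b_ratio := (b_ratio R).

Lemma near_root6_ge (K : R) : \forall n \near \oo, K <= root6 n.
Proof.
near=> n; have [K0|/ltW K0] := leP K 0; first exact: le_trans K0 (powR_ge0 _ _).
rewrite -(@ler_pXn2r _ 6) ?nnegrE ?powR_ge0 // root6X.
near: n; exact: nbhs_infty_ger.
Unshelve. all: by end_near. Qed.

(** Subexponential growth. The maximum lets one statement serve both ratios: the dominant term of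
    the recurrence is two steps back for a-structures and three steps back for b-structures. *)
Lemma growth_le x : (forall k, 0 <= x k) ->
  (forall eps, 0 < eps -> \forall n \near \oo,
    x n.+3 <= eps * (x n.+2 + x n.+1 + x n) + Num.max (x n.+1) (x n)) ->
  forall theta, 1 < theta -> exists2 M, 0 < M & forall n, x n <= M * theta ^+ n.
Proof.
move=> x0 rec theta t1; have t0 : 0 < theta by lra.
(* With T the bound at index k, this epsilon makes the small terms add up to at most (theta - 1)
   theta T, which raises theta T to theta^2 T, below the required theta^3 T. *)
have [N _ hN] := rec ((theta - 1) / (3 * theta)) ltac:(by rewrite divr_gt0 //; lra).
exists (1 + \sum_(i < N.+3) x i); first by rewrite ltr_pwDl // sumr_ge0.
set M := 1 + _; have M0 : 0 < M by rewrite ltr_pwDl // sumr_ge0.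
move=> n; have [m] := ubnP n; elim: m n => // m IH n nm.
have [nN|Nn] := ltnP n N.+3.
  apply: (@le_trans _ _ M); last by rewrite ler_peMr ?(ltW M0) // exprn_ege1 // ltW.
  by rewrite /M (bigD1 (Ordinal nN)) //= addrCA lerDl addr_ge0 // sumr_ge0.
have [k nE] : exists k, n = k.+3 by exists (n - 3)%N; lia.
have Nk : (N <= k)%N by lia.
rewrite nE; apply: le_trans (hN k Nk) _.
have h2 := IH k.+2 ltac:(lia); have h1 := IH k.+1 ltac:(lia); have h0 := IH k ltac:(lia).
have T0 : 0 < M * theta ^+ k by rewrite mulr_gt0 // exprn_gt0.
rewrite !exprS in h2 h1 *; set T := M * theta ^+ k in T0 h0.
have E1 : M * (theta * theta ^+ k) = theta * T by rewrite /T; ring.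
have E2 : M * (theta * (theta * theta ^+ k)) = theta ^+ 2 * T by rewrite /T; ring.
have E3 : M * (theta * (theta * (theta * theta ^+ k))) = theta ^+ 3 * T by rewrite /T; ring.
rewrite E1 in h1; rewrite E2 in h2; rewrite E3.
have l01 : T <= theta * T by rewrite ler_peMl // ltW.
have l12 : theta * T <= theta ^+ 2 * T by rewrite expr2 -mulrA ler_pM2l.
have hmax : Num.max (x k.+1) (x k) <= theta * T.
  by rewrite ge_max h1 /=; apply: le_trans h0 l01.
have hs : x k.+2 + x k.+1 + x k <= 3 * (theta ^+ 2 * T) by lra.
apply: (@le_trans _ _ ((theta - 1) / (3 * theta) * (3 * (theta ^+ 2 * T)) + theta * T)).
  by apply: lerD => //; rewrite ler_wpM2l // divr_ge0; lra.
have -> : (theta - 1) / (3 * theta) * (3 * (theta ^+ 2 * T)) + theta * T = theta ^+ 2 * T.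
  by field; rewrite gt_eqF.
by rewrite [_ ^+ 3]exprS -mulrA ler_peMl ?(ltW t1) // mulr_ge0 ?exprn_ge0 ?(ltW t0) ?(ltW T0).
Qed.

Lemma a_ratio_rec n : a_ratio n.+2 <= a_ratio n.+1 / root6 n.+2 ^+ 3 + a_ratio n.
Proof.
have r0 := rfact_gt0 R n.
have c10 := root6_gt0 R (ltn0Sn n); have c20 := root6_gt0 R (ltn0Sn n.+1).
have : n.+1%:R <= (root6 n.+1 * root6 n.+2) ^+ 3.
  rewrite -(@ler_pXn2r _ 2) ?nnegrE ?exprn_ge0 ?mulr_ge0 ?(ltW c10) ?(ltW c20) // -exprM exprMn !root6X.
  by rewrite -natrM -natrX ler_nat expnS expn1 leq_mul2l leqnSn orbT.
rewrite /a_ratio !rfactS a_countS natrD natrM /= => h.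
set c1 := root6 n.+1 in h c10 *; set c2 := root6 n.+2 in h c20 *; set r := rfact n in r0 *.
set s := (a_count n.+1)%:R; set t := (a_count n)%:R; set u := n.+1%:R in h *.
have -> : (s + u * t) / (r * c1 * c2) ^+ 3 = s / (r * c1) ^+ 3 / c2 ^+ 3 + (u / (c1 * c2) ^+ 3) * (t / r ^+ 3).
  by field; rewrite !gt_eqF.
rewrite lerD2l ler_piMl ?divr_ge0 ?exprn_ge0 ?(ltW r0) //.
by rewrite ler_pdivrMr ?mul1r // exprn_gt0 // mulr_gt0.
Qed.

Lemma b_ratio_rec n : b_ratio n.+3 <=
  b_ratio n.+2 / root6 n.+3 ^+ 4 + 2 / root6 n.+3 ^+ 2 * b_ratio n.+1 + b_ratio n.
Proof.
have r0 := rfact_gt0 R n.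
have c10 := root6_gt0 R (ltn0Sn n); have c20 := root6_gt0 R (ltn0Sn n.+1).
have c30 := root6_gt0 R (ltn0Sn n.+2).
have h1 : n.+2%:R <= root6 n.+2 ^+ 4 * root6 n.+3 ^+ 2.
  rewrite -(@ler_pXn2r _ 3) ?nnegrE ?mulr_ge0 ?exprn_ge0 ?(ltW c30) ?(ltW c20) //.
  rewrite [X in _ <= X]exprMn -!exprM -[(2 * 3)%N]/6%N [(4 * 3)%N](_ : _ = (6 * 2)%N) // exprM !root6X.
  by rewrite -!natrX -natrM ler_nat !expnS !expn0; nia.
rewrite /b_ratio !rfactS; have : n.+2%:R * n.+1%:R <= (root6 n.+1 * root6 n.+2 * root6 n.+3) ^+ 4.
  rewrite -(@ler_pXn2r _ 3) ?nnegrE ?exprn_ge0 ?mulr_ge0 ?(ltW c10) ?(ltW c20) ?(ltW c30) // -!exprM.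
  rewrite [(4 * 3)%N](_ : _ = (6 * 2)%N) // exprM [X in X ^+ 2]exprMn [X in (X * _) ^+ 2]exprMn !root6X.
  rewrite -!natrM -!natrX ler_nat !expnS !expn0; nia.
have -> : (b_count n.+3)%:R = (b_count n.+2)%:R + 2 * n.+2%:R * (b_count n.+1)%:R +
    n.+2%:R * n.+1%:R * (b_count n)%:R :> R.
  by rewrite b_countS natrD natrD natrM natrM natrM natrM.
move=> h2.
set c1 := root6 n.+1 in h2 c10 *; set c2 := root6 n.+2 in h1 h2 c20 *.
set c3 := root6 n.+3 in h1 h2 c30 *; set r := rfact n in r0 *.
set s := (b_count n.+2)%:R; set t := (b_count n.+1)%:R; set u := (b_count n)%:R.
set v := n.+2%:R in h1 h2 *; set w := n.+1%:R in h2 *.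
have -> : (s + 2 * v * t + v * w * u) / (r * c1 * c2 * c3) ^+ 4 =
  s / (r * c1 * c2) ^+ 4 / c3 ^+ 4 + v / (c2 ^+ 4 * c3 ^+ 2) * (2 / c3 ^+ 2 * (t / (r * c1) ^+ 4)) +
  (v * w / (c1 * c2 * c3) ^+ 4) * (u / r ^+ 4).
  by field; rewrite !gt_eqF.
apply: lerD; [rewrite lerD2l|]; rewrite ler_piMl.
- by [].
- by rewrite ?mulr_ge0 ?invr_ge0 ?exprn_ge0 ?mulr_ge0 ?(ltW r0) ?(ltW c10) ?(ltW c30).
- by rewrite ler_pdivrMr ?mul1r // mulr_gt0 // exprn_gt0.
- by [].
- by rewrite divr_ge0 ?exprn_ge0 ?(ltW r0).
- by rewrite ler_pdivrMr ?mul1r // exprn_gt0 // !mulr_gt0.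
Qed.

Lemma a_ratio_growth theta : 1 < theta -> exists2 M, 0 < M & forall n, a_ratio n <= M * theta ^+ n.
Proof.
have x0 k := ltW (a_ratio_gt0 R k); apply: growth_le => // eps eps0; near=> n.
have c1 : 1 <= root6 n.+3 by apply: root6_ge1.
have ce : 2 / eps <= root6 n.+3.
  near: n; have [N _ hN] := near_root6_ge (2 / eps).
  by exists N => // n /= Nn; apply: hN => /=; rewrite (leq_trans Nn) // -addn3 leq_addr.
apply: le_trans (a_ratio_rec n.+1) _; apply: lerD; last by rewrite le_max lexx.
rewrite mulrC; apply: ler_pM => //; first by rewrite invr_ge0 exprn_ge0 //; lra.
  rewrite -[leRHS]invrK lef_pV2 ?posrE ?invr_gt0 ?exprn_gt0 //; last lra.
  have : eps^-1 <= 2 / eps by rewrite ler_peMl ?invr_ge0 ?(ltW eps0) //; lra.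
  move=> h; apply: le_trans h _; apply: le_trans ce _.
  by rewrite exprS ler_peMr ?exprn_ege1 //; lra.
by have := x0 n.+1; have := x0 n; lra.
Unshelve. all: by end_near. Qed.

Lemma b_ratio_growth theta : 1 < theta -> exists2 M, 0 < M & forall n, b_ratio n <= M * theta ^+ n.
Proof.
have x0 k := ltW (b_ratio_gt0 R k); apply: growth_le => // eps eps0; near=> n.
have c1 : 1 <= root6 n.+3 by apply: root6_ge1.
have ce : 2 / eps <= root6 n.+3.
  near: n; have [N _ hN] := near_root6_ge (2 / eps).
  by exists N => // n /= Nn; apply: hN => /=; rewrite (leq_trans Nn) // -addn3 leq_addr.
apply: le_trans (b_ratio_rec n) _; apply: lerD; last by rewrite le_max lexx orbT.
set c := root6 n.+3 in c1 ce *; have c0 : 0 < c by lra.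
have e2 : 2 / c ^+ 2 <= eps.
  rewrite ler_pdivrMr ?exprn_gt0 // mulrC -ler_pdivrMr //.
  by apply: le_trans ce _; rewrite exprS ler_peMr ?exprn_ege1 // ltW.
have e1 : (c ^+ 4)^-1 <= eps.
  apply: le_trans e2; rewrite -[leLHS]mul1r ler_pM ?invr_ge0 ?exprn_ge0 ?(ltW c0) //; first lra.
  by rewrite lef_pV2 ?posrE ?exprn_gt0 // ler_weXn2l.
have m1 := ler_wpM2r (x0 n.+2) e1; have m2 := ler_wpM2r (x0 n.+1) e2.
have m0 : 0 <= eps * b_ratio n by rewrite mulr_ge0 // ltW.
rewrite !mulrDr; lra.
Unshelve. all: by end_near. Qed.

(** This is C(n,k)^(-1/6). *)
Definition split_weight n k : R := rfact k * rfact (n - k) / rfact n.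

Lemma split_weight_gt0 n k : 0 < split_weight n k.
Proof. by rewrite divr_gt0 ?mulr_gt0 ?rfact_gt0. Qed.

Lemma bin_split_weight n k : (k <= n)%N -> ('C(n, k))%:R * split_weight n k ^+ 6 = 1.
Proof.
move=> kn; rewrite /split_weight expr_div_n exprMn !rfactX mulrA -!natrM bin_fact //.
by rewrite divff // pnatr_eq0 -lt0n fact_gt0.
Qed.

Lemma split_weightX_le n k : (k <= n)%N -> (0 < n)%N ->
  split_weight n k ^+ 6 <= (k%:R / n%:R) ^+ k.
Proof.
move=> kn n0; have := bin_split_weight kn; set w := _ ^+ 6 => E.
have w0 : 0 < w by rewrite exprn_gt0 ?split_weight_gt0.
have := leq_expn_bin kn; rewrite -(ler_nat R) natrM !natrX => h.
rewrite expr_div_n ler_pdivlMr ?exprn_gt0 ?ltr0n // mulrC.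
apply: le_trans (_ : ('C(n, k)%:R * k%:R ^+ k) * w <= _); first by rewrite ler_wpM2r // ltW.
by rewrite mulrAC E mul1r.
Qed.

(** The counts contribute [split_weight] to the power 3 + 4 = 7, and the choice of the subset
    cancels six of these factors. The ratios of the small part grow at most like theta^k each, and
    those of the large part are bounded by the ratios at n through [ratio_le], whence the constants
    3^2 and 4^3. *)
Lemma split_count_le theta : 1 < theta -> exists2 C, 0 < C & forall n k, (k <= n)%N ->
  (split_count n k)%:R <= C * (theta ^+ (2 * k) * split_weight n k) * ((a_count n)%:R * (b_count n)%:R).
Proof.
move=> t1; have [A A0 hA] := a_ratio_growth t1; have [B B0 hB] := b_ratio_growth t1.
exists (A * B * (3 ^+ 2 * 4 ^+ 3)); first by rewrite !mulr_gt0 // exprn_gt0.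
move=> n k kn; set w := split_weight n k; have w0 : 0 < w := split_weight_gt0 n k.
have E := bin_split_weight kn; rewrite -/w in E.
have aE m : (a_count m)%:R = a_ratio m * rfact m ^+ 3.
  by rewrite /a_ratio mulfVK // expf_neq0 // gt_eqF ?rfact_gt0.
have bE m : (b_count m)%:R = b_ratio m * rfact m ^+ 4.
  by rewrite /b_ratio mulfVK // expf_neq0 // gt_eqF ?rfact_gt0.
have ha := @ratio_le R a_ratio 3 2 (n - k) n isT ltac:(lra) (fun k => ltW (a_ratio_gt0 R k))
  (@a_ratio_le_succ R) ltac:(move=> j; rewrite addn2; exact: a_ratio_le_add2) (leq_subr _ _).
have hb := @ratio_le R b_ratio 4 3 (n - k) n isT ltac:(lra) (fun k => ltW (b_ratio_gt0 R k))
  (@b_ratio_le_succ R) ltac:(move=> j; rewrite addn3; exact: b_ratio_le_add3) (leq_subr _ _).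
have wE : rfact k * rfact (n - k) = w * rfact n by rewrite /w /split_weight mulfVK // gt_eqF ?rfact_gt0.
rewrite /split_count !natrM.
have -> : 'C(n, k)%:R * ((a_count k)%:R * (a_count (n - k))%:R * ((b_count k)%:R * (b_count (n - k))%:R)) =
  (a_ratio k * b_ratio k * a_ratio (n - k) * b_ratio (n - k)) * (w * rfact n ^+ 7) :> R.
  have -> : w * rfact n ^+ 7 = 'C(n, k)%:R * (rfact k * rfact (n - k)) ^+ 7.
    by rewrite wE; transitivity (('C(n, k)%:R * w ^+ 6) * (w * rfact n ^+ 7)); [rewrite E mul1r | ring].
  by rewrite !aE !bE; ring.
have -> : A * B * (3 ^+ 2 * 4 ^+ 3) * (theta ^+ (2 * k) * w) * ((a_count n)%:R * (b_count n)%:R) =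
  ((A * theta ^+ k) * (B * theta ^+ k) * (3 ^+ 2 * a_ratio n) * (4 ^+ 3 * b_ratio n)) * (w * rfact n ^+ 7).
  by rewrite aE bE mul2n -addnn exprD; ring.
have p0 m := ltW (a_ratio_gt0 R m); have q0 m := ltW (b_ratio_gt0 R m).
apply: ler_wpM2r; first by rewrite mulr_ge0 ?exprn_ge0 ?(ltW w0) ?(ltW (rfact_gt0 R n)).
have leM4 (a b c d a' b' c' d' : R) : 0 <= a -> 0 <= b -> 0 <= c -> 0 <= d ->
    a <= a' -> b <= b' -> c <= c' -> d <= d' -> a * b * c * d <= a' * b' * c' * d'.
  by move=> *; do 3 (apply: ler_pM; rewrite ?mulr_ge0 //).
exact: leM4.
Qed.

(** Dominated convergence for sums: a geometric tail bounds all large indices uniformly in n, and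
    finitely many indices remain. *)
Lemma tannery (f : nat -> nat -> R) (h : nat -> nat) d : 0 < d < 1 ->
  (forall n k, 0 <= f n k) ->
  (forall n k, (0 < k <= h n)%N -> f n k <= d ^+ k) ->
  (forall k eps, 0 < eps -> \forall n \near \oo, f n k <= eps) ->
  forall eps, 0 < eps -> \forall n \near \oo, \sum_(1 <= k < (h n).+1) f n k <= eps.
Proof.
move=> /andP[d0 d1] f0 fd flim eps eps0.
have head K : forall eps, 0 < eps -> \forall n \near \oo, \sum_(k < K) f n k <= eps.
  elim: K => [|K IH] e e0; first by near=> n; rewrite big_ord0 ltW.
  near=> n; rewrite big_ord_recr /= (splitr e) lerD //; near: n.
    by apply: IH; rewrite divr_gt0.
  by apply: flim; rewrite divr_gt0.
have : \forall K \near \oo, d ^+ K <= eps / 2 * (1 - d).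
  have e1 : 0 < eps / 2 * (1 - d) by rewrite !mulr_gt0 ?subr_gt0.
  have := @cvg_expr R d; rewrite ger0_norm ?(ltW d0) // => /(_ d1)/cvgr0_norm_le/(_ _ e1).
  by apply: filterS => K; rewrite ger0_norm // exprn_ge0 // ltW.
case=> K0 _ /(_ K0.+1 (leqnSn K0)) /=; set K := K0.+1 => hK.
have e2 : 0 < eps / 2 by rewrite divr_gt0.
near=> n; have hn : \sum_(k < K) f n k <= eps / 2 by near: n; exact: head.
have tail m : \sum_(K <= k < K + m) d ^+ k <= eps / 2.
  rewrite -{1}(add0n K) big_addn addKn big_mkord.
  under eq_bigr do rewrite exprD.
  rewrite -mulr_suml mulrC; apply: le_trans (_ : d ^+ K / (1 - d) <= _); last first.
    by rewrite ler_pdivrMr ?subr_gt0.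
  rewrite ler_wpM2l ?exprn_ge0 ?(ltW d0) // -[leRHS]mul1r ler_pdivlMr ?subr_gt0 //.
  have := subrX1 d m; have := exprn_ge0 m (ltW d0); lra.
have split0 : \sum_(0 <= k < (h n).+1) f n k = f n 0%N + \sum_(1 <= k < (h n).+1) f n k.
  by rewrite big_ltn.
rewrite (splitr eps); have [hK2|Kh] := leqP (h n).+1 K.
  apply: le_trans (_ : eps / 2 <= _); last by lra.
  apply: le_trans hn; rewrite -(big_mkord xpredT (fun k => f n k)).
  rewrite [leRHS](big_cat_nat (n := (h n).+1)) //= split0.
  by rewrite -addrA addrCA lerDl addr_ge0 // sumr_ge0.
apply: le_trans (_ : \sum_(k < K) f n k + \sum_(K <= k < K + ((h n).+1 - K)) d ^+ k <= _); last exact: lerD.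
rewrite subnKC 1?ltnW //.
apply: le_trans (_ : \sum_(0 <= k < (h n).+1) f n k <= _).
  by rewrite split0 lerDr.
rewrite (big_cat_nat (n := K)) //= 1?ltnW // big_mkord lerD2l.
rewrite big_nat_cond [leRHS]big_nat_cond; apply: ler_sum => k; rewrite andbT => /andP[Kk kh].
by apply: fd; rewrite (leq_trans _ Kk).
Unshelve. all: by end_near. Qed.

End Split.

Section Tail.
Variable R : realType.

Lemma near_sum_split_count : \forall n \near \oo,
  (\sum_(1 <= k < n./2.+1) split_count n k)%:R <= 2^-1 * ((a_count n)%:R * (b_count n)%:R) :> R.
Proof.
have powX (a : R) m : 0 < a -> (0 < m)%N -> (a `^ m%:R^-1) ^+ m = a.
  by move=> a0 m0; rewrite -powR_mulrn ?powR_ge0 // -powRrM mulVf ?pnatr_eq0 -?lt0n // powRr1 // ltW.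
(* For k at most n/2, the sixth power of theta^(2k) C(n,k)^(-1/6) is at most (3/2 * k/n)^k, hence at
   most (3/4)^k; the two constants are the matching roots. *)
pose theta : R := (3 / 2) `^ 12%:R^-1; pose d : R := (3 / 4) `^ 6%:R^-1.
have thetaX : theta ^+ 12 = 3 / 2 by apply: powX => //; lra.
have dX : d ^+ 6 = 3 / 4 by apply: powX => //; lra.
have t0 : 0 < theta by rewrite powR_gt0; lra.
have d0 : 0 < d by rewrite powR_gt0; lra.
have t1 : 1 < theta.
  by rewrite -(@ltr_pXn2r _ 12) ?nnegrE ?ler01 ?(ltW t0) // thetaX expr1n; lra.
have d1 : d < 1.
  by rewrite -(@ltr_pXn2r _ 6) ?nnegrE ?ler01 ?(ltW d0) // dX expr1n; lra.
have [C C0 hC] := split_count_le t1.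
(* The weight at k = 0 equals 1; the boolean factor removes it, since [tannery] asks each term to
   tend to 0. *)
pose f n k : R := (k != 0%N)%:R * (theta ^+ (2 * k) * split_weight R n k).
have w0 n k : 0 <= theta ^+ (2 * k) * split_weight R n k.
  by rewrite mulr_ge0 ?exprn_ge0 ?(ltW t0) ?(ltW (split_weight_gt0 _ _ _)).
have f0 n k : 0 <= f n k by rewrite mulr_ge0.
have fX n k : (k <= n)%N -> (0 < n)%N ->
    (theta ^+ (2 * k) * split_weight R n k) ^+ 6 <= (3 / 2 * (k%:R / n%:R)) ^+ k.
  move=> kn n0; rewrite exprMn [leRHS]exprMn -exprM (_ : (2 * k * 6 = 12 * k)%N) ?exprM ?thetaX; last lia.
  by rewrite ler_wpM2l ?exprn_ge0 ?split_weightX_le //; lra.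
have fd n k : (0 < k <= n./2)%N -> f n k <= d ^+ k.
  move=> /andP[k0 kn]; rewrite /f -lt0n k0 mul1r.
  have kn' : (k <= n)%N by lia.
  have n0 : (0 < n)%N by lia.
  rewrite -(@ler_pXn2r _ 6) ?nnegrE ?exprn_ge0 ?(ltW d0) //.
  apply: le_trans (fX _ _ kn' n0) _; rewrite exprAC dX.
  rewrite lerXn2r ?nnegrE ?mulr_ge0 ?invr_ge0 //; try lra.
  have : k%:R / n%:R <= 1 / 2 :> R.
    rewrite ler_pdivrMr ?ltr0n // mulrC mulrA mulr1 ler_pdivlMr //.
    by rewrite -natrM ler_nat; lia.
  by move=> h; lra.
have flim k eps : 0 < eps -> \forall n \near \oo, f n k <= eps.
  move=> e0; have [->|k0] := eqVneq k 0%N; first by near=> n; rewrite /f eqxx mul0r ltW.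
  pose e := Num.min 1 (eps ^+ 6); have ee : 0 < e by rewrite lt_min ltr01 exprn_gt0.
  have [el1 el6] : e <= 1 /\ e <= eps ^+ 6 by rewrite /e !ge_min !lexx orbT.
  near=> n; rewrite /f k0 mul1r.
  have hn : 3 / 2 * k%:R / e <= n%:R by near: n; exact: nbhs_infty_ger.
  have kn : (k <= n)%N by near: n; exact: nbhs_infty_ge.
  have n0 : (0 < n)%N by rewrite (leq_trans _ kn) // lt0n.
  rewrite -(@ler_pXn2r _ 6) ?nnegrE ?(ltW e0) //.
  apply: le_trans (fX _ _ kn n0) _.
  have xe : 3 / 2 * (k%:R / n%:R) <= e.
    by rewrite mulrA ler_pdivrMr ?ltr0n // [e * _]mulrC -ler_pdivrMr.
  have x0 : 0 <= 3 / 2 * (k%:R / n%:R) :> R by rewrite mulr_ge0 ?divr_ge0.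
  apply: (@le_trans _ _ (3 / 2 * (k%:R / n%:R))); last first.
    exact: le_trans xe _.
  rewrite -[leRHS]expr1; apply: ler_wiXn2l; rewrite ?lt0n //.
  exact: le_trans xe _.
have C2 : 0 < (2 * C)^-1 by rewrite invr_gt0 mulr_gt0.
have d01 : 0 < d < 1 by rewrite d0.
have near_f := tannery d01 f0 fd flim C2.
near=> n.
have hf : \sum_(1 <= k < n./2.+1) f n k <= (2 * C)^-1 by near: n; exact: near_f.
rewrite natr_sum; apply: le_trans (_ : \sum_(1 <= k < n./2.+1) C * f n k * ((a_count n)%:R * (b_count n)%:R) <= _).
  rewrite big_nat_cond [leRHS]big_nat_cond; apply: ler_sum => k; rewrite andbT => /andP[k0 kn].
  by rewrite /f -lt0n k0 mul1r hC //; lia.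
rewrite -mulr_suml -mulr_sumr ler_wpM2r ?mulr_ge0 //.
apply: le_trans (ler_wpM2l (ltW C0) hf) _.
by rewrite invfM mulrCA mulfV ?mulr1 // gt_eqF.
Unshelve. all: by end_near. Qed.

(** * Exponential tails for loops and isolated b-edges *)

Lemma a_count_shift m q : (a_count m * m ^ q <= a_count (m + 2 * q))%N.
Proof.
elim: q => [|q IH]; first by rewrite muln1 muln0 addn0.
have -> : (m + 2 * q.+1 = (m + 2 * q).+2)%N by lia.
rewrite a_countS expnSr mulnA /=; apply: leq_trans (leq_addl _ _).
by rewrite mulnC leq_mul //; lia.
Qed.

(** Only the triangle term of the recurrence is kept, q times. *)
Lemma b_count_shift m q : (b_count m * m ^ (2 * q) <= b_count (m + 3 * q))%N.
Proof.
elim: q => [|q IH]; first by rewrite !muln0 muln1 addn0.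
have -> : (m + 3 * q.+1 = (m + 3 * q).+3)%N by lia.
rewrite b_countS mulnS addnC expnD mulnA /=; apply: leq_trans (leq_addl _ _).
by rewrite mulnC leq_mul // expnS expn1 leq_mul; lia.
Qed.

Lemma ffact_leq_expn n m : (n ^_ m <= n ^ m)%N.
Proof.
rewrite ffact_prod -[X in (_ ^ X)%N]card_ord -prod_nat_const; apply: leq_prod => i _.
exact: leq_subr.
Qed.

Lemma expn_subn_leq_ffact n m : ((n - m) ^ m <= n ^_ m)%N.
Proof.
apply: leq_trans (expn_leq_ffact _ _) _; rewrite !ffact_prod; apply: leq_prod => i _.
by rewrite leq_sub2r ?leq_pred.
Qed.

Lemma tail_ratio (c A U q x : nat) (gamma : R) : (c * U ^ q <= A ^ q * x)%N -> (0 < U)%N ->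
  0 <= gamma -> A%:R <= gamma * U%:R -> c%:R <= gamma ^+ q * x%:R.
Proof.
move=> h U0 g0 AU; have UX : 0 < U%:R ^+ q :> R by rewrite exprn_gt0 // ltr0n.
rewrite -(ler_pM2r UX) -natrX -natrM.
apply: le_trans (_ : (A ^ q * x)%:R <= _); first by rewrite ler_nat.
rewrite natrM !natrX mulrAC ler_wpM2r // -exprMn lerXn2r ?nnegrE ?mulr_ge0 //.
Qed.

(* The moment order is a multiple of 3 so that only the exact three-step bound
   [b_count_shift] is needed: the one-step bound loses a constant factor at each
   step. *)
Lemma edge_tail n m q (gamma : R) : (6 * q < n)%N -> (3 * q < m)%N -> 0 <= gamma ->
  (n ^ 6)%:R <= gamma * ((m - 3 * q) ^ 3 * (n - 6 * q) ^ 4)%:R ->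
  (#|[set Q in b_packings [set: 'I_n] | m <= #|Q :&: b_edge_blocks 'I_n|]%N|)%:R <=
    gamma ^+ q * (b_count n)%:R.
Proof.
move=> qn qm g0 h; apply: tail_ratio g0 h; last by rewrite muln_gt0 !expn_gt0 !subn_gt0 qn qm.
have mk := card_ffact_markov m (b_edge_ffact (3 * q) [set: 'I_n]).
rewrite cardsT card_ord (_ : (2 * (3 * q) = 6 * q)%N) in mk; last lia.
have sh := b_count_shift (n - 6 * q) (2 * q).
have -> : b_count n = b_count (n - 6 * q + 3 * (2 * q)) by congr b_count; lia.
rewrite (_ : (2 * (2 * q) = 4 * q)%N) in sh; last lia.
rewrite expnMn -!expnM mulnA.
apply: leq_trans (_ : (n ^_ (6 * q) * b_count (n - 6 * q) * (n - 6 * q) ^ (4 * q) <= _)%N).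
  by rewrite leq_mul2r; apply/orP; right; apply: leq_trans mk; rewrite leq_mul2l expn_subn_leq_ffact orbT.
by rewrite -mulnA leq_mul // ffact_leq_expn.
Qed.

(** The moment of order 3q frees 3q vertices, on which q triangles are rebuilt to compare with
    [b_count n]. *)
Lemma b_loop_tail n m q (gamma : R) : (3 * q < n)%N -> (3 * q < m)%N -> 0 <= gamma ->
  (n ^ 3)%:R <= gamma * ((m - 3 * q) ^ 3 * (n - 3 * q) ^ 2)%:R ->
  (#|[set Q in b_packings [set: 'I_n] | m <= #|Q :&: b_loop_blocks 'I_n|]%N|)%:R <=
    gamma ^+ q * (b_count n)%:R.
Proof.
move=> qn qm g0 h; apply: tail_ratio g0 h; last by rewrite muln_gt0 !expn_gt0 !subn_gt0 qn qm.
have mk := card_ffact_markov m (b_loop_ffact (3 * q) [set: 'I_n]).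
rewrite cardsT card_ord in mk.
have sh := b_count_shift (n - 3 * q) q.
have -> : b_count n = b_count (n - 3 * q + 3 * q) by congr b_count; lia.
rewrite expnMn -!expnM mulnA.
apply: leq_trans (_ : (n ^_ (3 * q) * b_count (n - 3 * q) * (n - 3 * q) ^ (2 * q) <= _)%N).
  by rewrite leq_mul2r; apply/orP; right; apply: leq_trans mk; rewrite leq_mul2l expn_subn_leq_ffact orbT.
by rewrite -mulnA leq_mul // ffact_leq_expn.
Qed.

(** The 2q vertices freed by the moment of order 2q are rebuilt into q a-edges. *)
Lemma a_loop_tail n m q (gamma : R) : (2 * q < n)%N -> (2 * q < m)%N -> 0 <= gamma ->
  (n ^ 2)%:R <= gamma * ((m - 2 * q) ^ 2 * (n - 2 * q))%:R ->
  (#|[set P in a_packings [set: 'I_n] | m <= #|P :&: a_loop_blocks 'I_n|]%N|)%:R <=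
    gamma ^+ q * (a_count n)%:R.
Proof.
move=> qn qm g0 h; apply: tail_ratio g0 h; last by rewrite muln_gt0 !expn_gt0 !subn_gt0 qn qm.
have mk := card_ffact_markov m (a_loop_ffact (2 * q) [set: 'I_n]).
rewrite cardsT card_ord in mk.
have sh := a_count_shift (n - 2 * q) q.
have -> : a_count n = a_count (n - 2 * q + 2 * q) by congr a_count; lia.
rewrite expnMn -!expnM mulnA.
apply: leq_trans (_ : (n ^_ (2 * q) * a_count (n - 2 * q) * (n - 2 * q) ^ q <= _)%N).
  by rewrite leq_mul2r; apply/orP; right; apply: leq_trans mk; rewrite leq_mul2l expn_subn_leq_ffact orbT.
by rewrite -mulnA leq_mul // ffact_leq_expn.
Qed.

Lemma bernoulli (k : R) n : 0 <= k <= 1 -> 1 - n%:R * k <= (1 - k) ^+ n.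
Proof.
move=> /andP[k0 k1]; elim: n => [|n IH]; first by rewrite mul0r subr0.
apply: le_trans (_ : (1 - k) * (1 - n%:R * k) <= _); last by rewrite exprS ler_wpM2l // subr_ge0.
have : 0 <= n%:R * k ^+ 2 by rewrite mulr_ge0 ?exprn_ge0.
by rewrite -[n.+1]addn1 natrD; lra.
Qed.

Lemma natr_subn_ge (m k : nat) : m%:R - k%:R <= (m - k)%:R :> R.
Proof.
have [km|mk] := leqP k m; first by rewrite natrB.
by apply: le_trans (ler0n _ _); rewrite subr_le0 ler_nat ltnW.
Qed.

Definition root3 n : R := n%:R `^ 3^-1.

Lemma root3_ge0 n : 0 <= root3 n. Proof. exact: powR_ge0. Qed.

Lemma root3X n : root3 n ^+ 3 = n%:R.
Proof. by rewrite /root3 -powR_mulrn ?powR_ge0 // -powRrM mulVf ?pnatr_eq0 // powRr1. Qed.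

Lemma near_root3_ge (K : R) : \forall n \near \oo, K <= root3 n.
Proof.
near=> n; have [K0|/ltW K0] := leP K 0; first exact: le_trans K0 (powR_ge0 _ _).
rewrite -(@ler_pXn2r _ 3) ?nnegrE ?powR_ge0 // root3X.
near: n; exact: nbhs_infty_ger.
Unshelve. all: by end_near. Qed.

Lemma near_card_packing_potential (mu : R) : 0 < mu -> exists2 gamma : R, 0 < gamma < 1 &
  \forall n \near \oo, forall m : nat, (2 + mu) * root3 n ^+ 2 <= m%:R ->
    (#|[set x in packing_pairs 'I_n | m <= packing_potential x]%N|)%:R <=
      3 * gamma `^ root3 n * ((a_count n)%:R * (b_count n)%:R).
Proof.
(* The thresholds will be delta n^(2/3) for both kinds of loops and (1 + delta) n^(2/3) for isolated
   b-edges. Beyond 2 n^(2/3) they use (7 + 2) delta n^(2/3), half of the room mu n^(2/3) = 18 delta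
   n^(2/3); the other half absorbs rounding. *)
move=> mu0; pose delta := mu / 18; have dl0 : 0 < delta by rewrite divr_gt0.
have od : 0 < 1 + delta by lra.
pose gamma := (1 + delta)^-1; have g0 : 0 < gamma by rewrite invr_gt0.
have gE : gamma * (1 + delta) = 1 by rewrite mulVf // gt_eqF.
have g1 : gamma < 1 by rewrite invf_lt1 //; lra.
exists gamma; first by rewrite g0.
(* kappa is the relative loss allowed when 3q or 6q is subtracted from a threshold or from n. The
   edge tail raises 1 - kappa to the power 3 + 4 = 7, so 7 kappa = 1 - gamma is what Bernoulli's
   inequality requires. *)
pose kappa := delta / (7 * (1 + delta)).
have kE : 7 * kappa = 1 - gamma by rewrite /kappa /gamma; field; rewrite gt_eqF.
have k0 : 0 < kappa by lra.
have k1 : kappa < 1 by lra.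
near=> n => m hm.
have y1 : 12 <= root3 n by near: n; exact: near_root3_ge.
have yk : 12 / kappa <= root3 n by near: n; exact: near_root3_ge.
have yd : 12 / delta <= root3 n by near: n; exact: near_root3_ge.
have yL : 32 / (gamma * delta ^+ 3) <= root3 n by near: n; exact: near_root3_ge.
have yM : 8 / (gamma * delta ^+ 2) <= root3 n by near: n; exact: near_root3_ge.
have ym : 2 / mu <= root3 n by near: n; exact: near_root3_ge.
have yX := root3X n; set y := root3 n in y1 yk yd yL yM ym yX hm *.
have y0 : 0 < y by lra.
rewrite ler_pdivrMr // in yk; rewrite ler_pdivrMr // in yd; rewrite ler_pdivrMr // in ym.
rewrite ler_pdivrMr ?mulr_gt0 ?exprn_gt0 // in yL.
rewrite ler_pdivrMr ?mulr_gt0 ?exprn_gt0 // in yM.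
(* q is about n^(1/3), rounded up, so that gamma^q is at most gamma^(n^(1/3)), while 6q is at most
   12 n^(1/3) and stays negligible against n^(2/3). *)
have [q1 q2] : y <= (Num.truncn y).+1%:R /\ (Num.truncn y).+1%:R <= y + 1.
  by have /andP[h1 h2] := truncn_itv (ltW y0); rewrite ltW // -natr1; split=> //; lra.
set q := (Num.truncn y).+1 in q1 q2.
pose up (z : R) := (Num.truncn z).+1.
have upP z : 0 <= z -> z <= (up z)%:R /\ (up z)%:R <= z + 1.
  by move=> z0; have /andP[h1 h2] := truncn_itv z0; rewrite ltW // /up -natr1; split=> //; lra.
have y2 : 0 < y ^+ 2 by rewrite exprn_gt0.
have y2y : 12 * y <= y ^+ 2 by rewrite expr2 ler_wpM2r // ltW.
have y21 : 1 <= y ^+ 2 by lra.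
have y3y : 12 * y ^+ 2 <= y ^+ 3 by rewrite [leRHS]exprS ler_wpM2r // ltW.
have [l1 l2] := upP (delta * y ^+ 2) ltac:(by rewrite mulr_ge0 ?(ltW dl0) ?(ltW y2)).
have [e1 e2] := upP ((1 + delta) * y ^+ 2) ltac:(by rewrite mulr_ge0 ?(ltW od) ?(ltW y2)).
set l := up _ in l1 l2; set e := up _ in e1 e2.
have hle : (7 * l + 2 * e <= m + 8)%N.
  rewrite -(ler_nat R) !natrD !natrM; clear - hm l2 e2 ym y1 dl0 mu0.
  have : 24 <= y * mu * y by have := ler_pM (ler0n _ 2) (ler0n _ 12) ym y1; lra.
  have -> : y * mu * y = 18 * (delta * y ^+ 2) by rewrite /delta; field.
  have h : (2 + mu) * y ^+ 2 = 2 * y ^+ 2 + 18 * (delta * y ^+ 2) by rewrite /delta; field.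
  by rewrite h in hm; lra.
have dy : 12 * y <= delta * y ^+ 2 by rewrite expr2 mulrA ler_pM2r // mulrC.
have ky : 12 * y <= kappa * y ^+ 2 by rewrite expr2 mulrA ler_pM2r // mulrC.
have ky3 : 12 * y ^+ 2 <= kappa * y ^+ 3 by rewrite [y ^+ 3]exprSr expr2 mulrA mulrA -expr2 ler_pM2r // -mulrA -expr2.
have N6 : n%:R - (6 * q)%:R <= (n - 6 * q)%:R :> R by exact: natr_subn_ge.
have N3 : n%:R - (3 * q)%:R <= (n - 3 * q)%:R :> R by exact: natr_subn_ge.
have N2 : n%:R - (2 * q)%:R <= (n - 2 * q)%:R :> R by exact: natr_subn_ge.
have E3 : e%:R - (3 * q)%:R <= (e - 3 * q)%:R :> R by exact: natr_subn_ge.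
have L3 : l%:R - (3 * q)%:R <= (l - 3 * q)%:R :> R by exact: natr_subn_ge.
have L2 : l%:R - (2 * q)%:R <= (l - 2 * q)%:R :> R by exact: natr_subn_ge.
rewrite !natrM -yX in N6 N3 N2 E3 L3 L2.
have kd : 0 <= delta * y ^+ 2 by rewrite mulr_ge0 ?(ltW dl0) ?(ltW y2).
have v6 : (1 - kappa) * y ^+ 3 <= (n - 6 * q)%:R by lra.
have v3 : 2^-1 * y ^+ 3 <= (n - 3 * q)%:R by lra.
have v2 : 2^-1 * y ^+ 3 <= (n - 2 * q)%:R by lra.
have kdy : 0 <= kappa * (delta * y ^+ 2) by rewrite mulr_ge0 // ltW.
have u3 : (1 + delta) * (1 - kappa) * y ^+ 2 <= (e - 3 * q)%:R by lra.
have w3 : delta / 2 * y ^+ 2 <= (l - 3 * q)%:R by lra.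
have w2 : delta / 2 * y ^+ 2 <= (l - 2 * q)%:R by lra.
have y3 : 0 < y ^+ 3 by rewrite exprn_gt0.
have half : 0 < 2^-1 :> R by rewrite invr_gt0.
have pos m1 k' (z : R) : 0 < z -> z <= (m1 - k')%:R -> (k' < m1)%N.
  by move=> z0 /(lt_le_trans z0); rewrite ltr0n subn_gt0.
have kap0 : 0 < 1 - kappa by lra.
have d20 : 0 < delta / 2 by rewrite divr_gt0.
have tE := @edge_tail n e q gamma (pos _ _ _ (mulr_gt0 kap0 y3) v6)
  (pos _ _ _ (mulr_gt0 (mulr_gt0 od kap0) y2) u3) (ltW g0).
have tB := @b_loop_tail n l q gamma (pos _ _ _ (mulr_gt0 half y3) v3)
  (pos _ _ _ (mulr_gt0 d20 y2) w3) (ltW g0).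
have tA := @a_loop_tail n l q gamma (pos _ _ _ (mulr_gt0 half y3) v2)
  (pos _ _ _ (mulr_gt0 d20 y2) w2) (ltW g0).
have powle (z z' : R) p : 0 < z -> z <= z' -> z ^+ p <= z' ^+ p.
  by move=> z0 zz; rewrite lerXn2r ?nnegrE ?(ltW z0) // (le_trans (ltW z0)).
have mono (z1 z2 t1 t2 : R) i j : 0 < z1 -> z1 <= z2 -> 0 < t1 -> t1 <= t2 ->
    gamma * (z1 ^+ i * t1 ^+ j) <= gamma * (z2 ^+ i * t2 ^+ j).
  move=> z0 z12 t0 t12; rewrite ler_wpM2l ?(ltW g0) // ler_pM ?powle //.
    by rewrite exprn_ge0 // ltW.
  by rewrite exprn_ge0 // ltW.
have {}tE : (#|[set Q in b_packings [set: 'I_n] | e <= #|Q :&: b_edge_blocks 'I_n|]%N|)%:R <=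
    gamma ^+ q * (b_count n)%:R.
  apply: tE; rewrite natrX -yX natrM !natrX.
  apply: le_trans (_ : gamma * (((1 + delta) * (1 - kappa) * y ^+ 2) ^+ 3 * ((1 - kappa) * y ^+ 3) ^+ 4) <= _); last first.
    exact: mono (mulr_gt0 (mulr_gt0 od kap0) y2) u3 (mulr_gt0 kap0 y3) v6.
  have -> : gamma * (((1 + delta) * (1 - kappa) * y ^+ 2) ^+ 3 * ((1 - kappa) * y ^+ 3) ^+ 4) =
     ((gamma * (1 + delta)) * (1 + delta) ^+ 2 * (1 - kappa) ^+ 7) * (y ^+ 3) ^+ 6 by ring.
  rewrite gE mul1r; move: ((y ^+ 3) ^+ 6) (exprn_gt0 6 y3) => Y Y0; apply: ler_peMl; first exact: ltW.
  (* One factor 1 + delta has cancelled gamma; of the two left, one cancels the gamma that bounds (1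
     - kappa)^7 from below, and the last one exceeds 1. *)
  have b7 : gamma <= (1 - kappa) ^+ 7.
    have := @bernoulli kappa 7 ltac:(by rewrite (ltW k0) (ltW k1)).
    by rewrite kE opprB addrC subrK.
  apply: le_trans (_ : (1 + delta) ^+ 2 * gamma <= _); last first.
    by rewrite ler_wpM2l ?exprn_ge0 ?(ltW od).
  by rewrite expr2 -mulrA [_ * gamma]mulrC gE mulr1 lerDl ltW.
have {}tB : (#|[set Q in b_packings [set: 'I_n] | l <= #|Q :&: b_loop_blocks 'I_n|]%N|)%:R <=
    gamma ^+ q * (b_count n)%:R.
  apply: tB; rewrite natrX -yX natrM !natrX.
  apply: le_trans (_ : gamma * ((delta / 2 * y ^+ 2) ^+ 3 * (2^-1 * y ^+ 3) ^+ 2) <= _); last first.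
    exact: mono (mulr_gt0 d20 y2) w3 (mulr_gt0 half y3) v3.
  (* The threshold is far above the typical n^(1/3), so a factor y^3 is to spare; it absorbs the
     constants. For a-loops a single factor y is to spare. *)
  have -> : gamma * ((delta / 2 * y ^+ 2) ^+ 3 * (2^-1 * y ^+ 3) ^+ 2) =
     ((y * (gamma * delta ^+ 3)) * y ^+ 2 / 32) * (y ^+ 3) ^+ 3 by field.
  move: ((y ^+ 3) ^+ 3) (exprn_gt0 3 y3) => Y Y0; apply: ler_peMl; first exact: ltW.
  rewrite ler_pdivlMr ?mul1r //.
  apply: le_trans (yL) _; apply: ler_peMr => //; exact: le_trans yL.
have {}tA : (#|[set P in a_packings [set: 'I_n] | l <= #|P :&: a_loop_blocks 'I_n|]%N|)%:R <=
    gamma ^+ q * (a_count n)%:R.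
  apply: tA; rewrite natrX -yX natrM !natrX.
  apply: le_trans (_ : gamma * ((delta / 2 * y ^+ 2) ^+ 2 * (2^-1 * y ^+ 3)) <= _); last first.
    exact: (@mono _ _ _ _ 2 1 (mulr_gt0 d20 y2) w2 (mulr_gt0 half y3) v2).
  have -> : gamma * ((delta / 2 * y ^+ 2) ^+ 2 * (2^-1 * y ^+ 3)) =
     ((y * (gamma * delta ^+ 2)) / 8) * (y ^+ 3) ^+ 2 by field.
  move: ((y ^+ 3) ^+ 2) (exprn_gt0 2 y3) => Y Y0; apply: ler_peMl; first exact: ltW.
  by rewrite ler_pdivlMr ?mul1r.
have := card_packing_potential_le n hle.
move=> cover; have gq : gamma ^+ q <= gamma `^ y.
  by rewrite -powR_mulrn ?(ltW g0) // ger_powR // g0 (ltW g1).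
have gy0 : 0 <= gamma `^ y := powR_ge0 _ _.
move: cover; rewrite -(ler_nat R) natrD natrD natrM natrM natrM => cover; apply: le_trans cover _.
set a := (a_count n)%:R in tA *; set b := (b_count n)%:R in tE tB *.
have a0 : 0 <= a by []; have b0 : 0 <= b by [].
have hE := ler_wpM2l a0 (le_trans tE (ler_wpM2r b0 gq)).
have hB := ler_wpM2l a0 (le_trans tB (ler_wpM2r b0 gq)).
have hA := ler_wpM2r b0 (le_trans tA (ler_wpM2r a0 gq)).
by clear - hE hB hA; lra.
Unshelve. all: by end_near. Qed.

End Tail.

(** * Conditioning on connectedness and the two estimates *)

Section Final.
Variable R : realType.
Notation root3 := (root3 R).

Lemma root3_sqr n : n%:R `^ (2 / 3) = root3 n ^+ 2 :> R.
Proof. by rewrite /root3 -powR_mulrn ?powR_ge0 // -powRrM mulrC. Qed.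

(** For the average, n times the failure probability must be small against n^(2/3), which is this
    limit after division. It follows from writing gamma^y as exp(cy/2)^(-2) with exp(x) at least
    x. *)
Lemma near_root3_powR (gamma eps : R) : 0 < gamma < 1 -> 0 < eps ->
  \forall n \near \oo, root3 n * gamma `^ root3 n <= eps.
Proof.
move=> /andP[g0 g1] e0; pose c := - ln gamma.
have c0 : 0 < c by rewrite oppr_gt0 ln_lt0 // g0.
near=> n.
have y1 : 1 <= root3 n by near: n; exact: near_root3_ge.
have yc : 4 / (c ^+ 2 * eps) <= root3 n by near: n; exact: near_root3_ge.
set y := root3 n in y1 yc *; have y0 : 0 < y by lra.
have gE : gamma `^ y = (expR (c * y / 2) ^+ 2)^-1.
  rewrite /powR gt_eqF // -expRM_natl -expRN /c; congr expR; by field.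
have cy : 0 < c * y / 2 by rewrite divr_gt0 ?mulr_gt0.
have h1 : (c * y / 2) ^+ 2 <= expR (c * y / 2) ^+ 2.
  rewrite lerXn2r ?nnegrE ?(ltW cy) ?(ltW (expR_gt0 _)) //.
  by apply: le_trans (expR_ge1Dx _); rewrite lerDr.
have X0 : 0 < expR (c * y / 2) ^+ 2 by rewrite exprn_gt0 // expR_gt0.
rewrite gE ler_pdivrMr //; apply: le_trans (ler_wpM2l (ltW e0) h1).
rewrite ler_pdivrMr ?mulr_gt0 ?exprn_gt0 // in yc.
have -> : eps * (c * y / 2) ^+ 2 = y * (y * (c ^+ 2 * eps) / 4) by field.
by rewrite ler_peMr ?(ltW y0) // ler_pdivlMr ?mul1r.
Unshelve. all: by end_near. Qed.

Lemma near_card_labeled_rooted_reduced : \forall n \near \oo,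
  2^-1 * (n%:R * ((a_count n)%:R * (b_count n)%:R)) <= (#|labeled_rooted_reduced n|)%:R :> R.
Proof.
near=> n.
have h : (\sum_(1 <= k < n./2.+1) split_count n k)%:R <= 2^-1 * ((a_count n)%:R * (b_count n)%:R) :> R.
  by near: n; exact: near_sum_split_count.
have := card_labeled_rooted_reduced n; rewrite -(ler_nat R) natrD !natrM.
have := ler_wpM2l (ler0n R n) h; set u := n%:R * (_ * _); set v := n%:R * _%:R.
have -> : n%:R * (2^-1 * ((a_count n)%:R * (b_count n)%:R)) = 2^-1 * u by rewrite /u; ring.
by clear; lra.
Unshelve. all: by end_near. Qed.

(** The constant is 24 = 4 * 3 * 2: the four pairs of booleans, the three tails, and the half of the
    pairs known to be connected. *)
Lemma near_card_small_silh (mu : R) : 0 < mu -> exists2 gamma : R, 0 < gamma < 1 &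
  \forall n \near \oo,
    (0 < #|labeled_rooted_reduced n|)%N /\
    (#|[set x in labeled_rooted_reduced n |
       (rooted_silh_size x)%:R < n%:R - (2 + mu) * n%:R `^ (2 / 3) :> R]%SET|)%:R <=
    24 * gamma `^ root3 n * (#|labeled_rooted_reduced n|)%:R.
Proof.
move=> mu0; have [gamma g01 near_pot] := near_card_packing_potential mu0.
exists gamma => //; near=> n.
have n0 : (0 < n)%N by near: n; exact: nbhs_infty_gt.
have hS : 2^-1 * (n%:R * ((a_count n)%:R * (b_count n)%:R)) <= (#|labeled_rooted_reduced n|)%:R :> R.
  by near: n; exact: near_card_labeled_rooted_reduced.
have hpot : forall m : nat, (2 + mu) * root3 n ^+ 2 <= m%:R ->
    (#|[set x in packing_pairs 'I_n | m <= packing_potential x]%N|)%:R <=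
      3 * gamma `^ root3 n * ((a_count n)%:R * (b_count n)%:R).
  by near: n.
have ab0 : 0 < n%:R * ((a_count n)%:R * (b_count n)%:R) :> R.
  by rewrite !mulr_gt0 ?ltr0n ?a_count_gt0 ?b_count_gt0.
split; first by rewrite -(ltr0n R); apply: lt_le_trans hS; rewrite mulr_gt0 // invr_gt0.
rewrite root3_sqr; set z := (2 + mu) * _ in hpot *.
have z0 : 0 <= z by rewrite mulr_ge0 ?exprn_ge0 ?root3_ge0 // addr_ge0 // ltW.
have /andP[t1 t2] := truncn_itv z0.
(* A loss of more than z vertices forces an integer potential above z, hence at least the truncation
   of z plus 1. *)
have hm := hpot (Num.truncn z).+1 (ltW t2).
apply: le_trans (_ : (#|[set x in labeled_rooted_reduced n |
    (Num.truncn z < potential (forget_root x.1 x.2))%N]|)%:R <= _).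
  rewrite ler_nat; apply: subset_leq_card; apply/fintype.subsetP=> x.
  rewrite !finset.in_set => /andP[xS xz]; apply/andP; split=> //.
  have xS' : x \in labeled_rooted_reduced n by rewrite finset.in_set.
  have := rooted_silh_size_potential xS'; rewrite -(ler_nat R) natrD => le.
  by rewrite -(ltr_nat R); apply: le_lt_trans t1 _; lra.
have := card_potential_forget_root n (Num.truncn z).+1.
rewrite -(ler_nat R) natrM natrM => le; apply: le_trans le _.
apply: le_trans (ler_wpM2l _ hm) _; first by rewrite mulr_ge0.
have gy : 0 <= 24 * gamma `^ root3 n by rewrite mulr_ge0 ?powR_ge0.
apply: le_trans (ler_wpM2l gy hS).
by rewrite le_eqVlt; apply/orP; left; apply/eqP; field.
Unshelve. all: by end_near. Qed.

(** On the exceptional event the variable is only known to be nonnegative, which costs at most [N]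
    there. *)
Lemma average_ge (T : finType) (S : {set T}) (X : T -> R) (N z p : R) :
  (0 < #|S|)%N -> 0 <= N -> 0 <= z -> (forall x, 0 <= X x) ->
  (#|[set x in S | X x < N - z]%SET|)%:R <= p * (#|S|)%:R ->
  N - z - N * p <= average S X.
Proof.
move=> S0 N0 z0 X0 hp; have SR : 0 < (#|S|)%:R :> R by rewrite ltr0n.
rewrite /average ler_pdivlMr //.
apply: (@le_trans _ _ (\sum_(x in S) (N - z - N * (X x < N - z)%R%:R))); last first.
  apply: ler_sum => x _; case: ltP => h; last by rewrite mulr0 subr0.
  by apply: le_trans (X0 x); rewrite mulr1; lra.
rewrite sumrB sumr_const -mulr_sumr -[(N - z) *+ _]mulr_natr mulrBl lerD2l lerN2 -mulrA ler_wpM2l //.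
apply: le_trans hp; rewrite -natr_sum ler_nat -sum1_card big_mkcond [leqRHS]big_mkcond /=.
by apply: leq_sum => x _; rewrite finset.in_set; case: (x \in S) => //=; case: (_ < _).
Qed.

End Final.

Theorem proposition3p10 (R : realType) :
  (exists e : nat -> R,
     e =o_\oo (fun n : nat => n%:R `^ (2 / 3)) /\
     forall n : nat, (0 < n)%N ->
       n%:R - 2 * n%:R `^ (2 / 3) + e n <
       average (labeled_rooted_reduced n)
               (fun x => (rooted_silh_size x)%:R)) /\
  (forall mu : R, 0 < mu ->
     exists2 gamma : R, 0 < gamma < 1 &
       (fun n : nat =>
          uniform_proba R (labeled_rooted_reduced n)
            (fun x => (rooted_silh_size x)%:R <
                      n%:R - (2 + mu) * n%:R `^ (2 / 3)))
       =O_\oo (fun n : nat => gamma `^ (n%:R `^ (1 / 3)))).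
Proof.
split; last first.
  move=> mu mu0; have [gamma g01 near_small] := near_card_small_silh mu0.
  exists gamma => //; apply/eqO_exP; exists 24 => //; near=> n.
  have [S0 hS] : (0 < #|labeled_rooted_reduced n|)%N /\
    (#|[set x in labeled_rooted_reduced n |
       (rooted_silh_size x)%:R < n%:R - (2 + mu) * n%:R `^ (2 / 3) :> R]%SET|)%:R <=
    24 * gamma `^ root3 R n * (#|labeled_rooted_reduced n|)%:R by near: n.
  rewrite div1r -/(root3 R n) [X in _ <= _ * X]ger0_norm ?powR_ge0 //.
  by rewrite ger0_norm ?divr_ge0 // ler_pdivrMr // ltr0n.
pose avg n : R := average (labeled_rooted_reduced n) (fun x => (rooted_silh_size x)%:R).
pose gap n := avg n - (n%:R - 2 * n%:R `^ (2 / 3)).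
(* The minimum with 0 keeps only the deficit of the average, and subtracting 1 makes the inequality
   strict for every n; only the order of the deficit remains to be bounded. *)
exists (fun n => Num.min 0 (gap n) - 1); split; last first.
  move=> n _; rewrite -/(avg n); have : Num.min 0 (gap n) <= gap n by rewrite ge_min lexx orbT.
  by rewrite {2}/gap; lra.
apply/eqoP => eps eps0.
(* The budget is a quarter of eps for mu, a quarter for the exceptional event (24 times eps/96), and
   a quarter for the subtracted 1. *)
have e4 : 0 < eps / 4 by rewrite divr_gt0.
have [gamma g01 near_small] := near_card_small_silh e4.
have e96 : 0 < eps / 96 by rewrite divr_gt0.
near=> n.
have [S0 hS] : (0 < #|labeled_rooted_reduced n|)%N /\
    (#|[set x in labeled_rooted_reduced n |
       (rooted_silh_size x)%:R < n%:R - (2 + eps / 4) * n%:R `^ (2 / 3) :> R]%SET|)%:R <=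
    24 * gamma `^ root3 R n * (#|labeled_rooted_reduced n|)%:R by near: n.
have yg : root3 R n * gamma `^ root3 R n <= eps / 96 by near: n; exact: near_root3_powR.
have ye : Num.max 1 (4 / eps) <= root3 R n by near: n; exact: near_root3_ge.
have z0 : 0 <= (2 + eps / 4) * n%:R `^ (2 / 3) by rewrite mulr_ge0 ?powR_ge0 // addr_ge0 // ltW.
have := average_ge S0 (ler0n R n) z0 (fun x => ler0n R _) hS.
rewrite -/(avg n) /gap [`| _ `^ _|]ger0_norm ?powR_ge0 // root3_sqr.
move: ye; rewrite ge_max => /andP[y1 ye]; have nE := root3X R n.
set y := root3 R n in yg y1 ye nE *; rewrite -nE.
have y2 : 0 <= y ^+ 2 by rewrite exprn_ge0; lra.
have h1 : y ^+ 3 * (24 * gamma `^ y) <= eps / 4 * y ^+ 2.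
  have := ler_wpM2r y2 yg.
  have -> : y ^+ 3 * (24 * gamma `^ y) = 24 * (y * gamma `^ y * y ^+ 2) by ring.
  by clear; lra.
have h2 : 1 <= eps / 4 * y ^+ 2.
  rewrite ler_pdivrMr // in ye.
  have : y <= y ^+ 2 by rewrite expr2 ler_peMr //; lra.
  move=> yy; have := ler_wpM2l (ltW eps0) yy; clear - ye; lra.
move=> h3; rewrite ler0_norm.
  rewrite opprB lerBlDr.
  have : - (eps / 2 * y ^+ 2) <= Num.min 0 (avg n - (y ^+ 3 - 2 * y ^+ 2)).
    by rewrite le_min; apply/andP; split; [rewrite oppr_le0 mulr_ge0 //; lra | lra].
  lra.
have : Num.min 0 (avg n - (y ^+ 3 - 2 * y ^+ 2)) <= 0 by rewrite ge_min lexx.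
lra.
Unshelve. all: by end_near. Qed.
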